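(* Let $p\in[1,\infty]$, let $E$ be a weakly $p$-angelic and locally complete locally convex space, and let $H:=\big(E',\mu(E',E)\big)$. Then a bounded subset $B$ of $H$ is precompact if and only if it is a $(p,\infty)$-limited set (in $H$).
   Context: All locally convex spaces are Hausdorff, over $\mathbb{F}\in\{\mathbb{R},\mathbb{C}\}$; $\omega=\{0,1,2,\dots\}$; $B$ is non-empty. $E'$ is the topological dual of $E$; $\mu(E',E)$ is the Mackey topology on $E'$, i.e. the finest locally convex topology on $E'$ whose topological dual is $E$ (so $H'=E$). Precompact means totally bounded. $E$ is locally complete if the closed absolutely convex hull of each null sequence in $E$ is compact. A sequence $\{x_n\}_{n\in\omega}$ in $E$ is weakly $p$-summable if $(\langle\chi,x_n\rangle)_n\in\ell_p$ (or $\in c_0$ if $p=\infty$) for every $\chi\in E'$; it is weakly $p$-convergent to $x\in E$ if $\{x_n-x\}$ is weakly $p$-summable. A subset $A$ of $E$ is relatively weakly sequentially $p$-compact if every sequence in $A$ has a subsequence that is weakly $p$-convergent to a point of $E$. $A$ is relatively weakly compact if its weak closure is compact in the weak topology. $E$ is weakly sequentially $p$-angelic if the family of all relatively weakly sequentially $p$-compact subsets of $E$ coincides with the family of all relatively weakly compact subsets of $E$. $E$ is weakly $p$-angelic if it is weakly sequentially $p$-angelic and each weakly compact subset of $E$ is Fréchet–Urysohn in the weak topology (i.e. whenever a point is in the closure of a subset of it, some sequence from that subset converges to the point). A non-empty subset $B$ of an lcs $H$ is $(p,\infty)$-limited if $\sup_{b\in B}|\langle\chi_n,b\rangle|\to0$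 for every sequence $\{\chi_n\}$ in $H'$ which is weak$^\ast$ $p$-summable, i.e. such that $(\langle\chi_n,h\rangle)_n\in\ell_p$ (or $\in c_0$ if $p=\infty$) for every $h\in H$. *)

(* Defs.v *)
From HB Require Import structures.
From mathcomp Require Import all_boot all_order all_algebra.
From mathcomp Require Import complex.
From mathcomp Require Import all_classical all_reals all_analysis.

Set Implicit Arguments.
Unset Strict Implicit.
Unset Printing Implicit Defensive.

Import Order.TTheory GRing.Theory Num.Theory.
Import numFieldTopology.Exports numFieldNormedType.Exports.

Local Open Scope classical_set_scope.
Local Open Scope ring_scope.

Inductive scalar_kind := RealScalars | ComplexScalars.

Definition scalars (R : realType) (F : scalar_kind) : numFieldType :=
  match F with RealScalars => R | ComplexScalars => R[i] end.

(* The norm of [R[i]] takes its values in [R[i]]; [modulus] is the same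
   absolute value with values in [R]. *)
Definition modulus (R : realType) (F : scalar_kind) : scalars R F -> R :=
  match F return scalars R F -> R with
  | RealScalars => fun x => `|x|
  | ComplexScalars => fun z => ComplexField.Normc.normc z
  end.

(* [l_p], with [c_0] in place of [l_oo]. *)
Definition lp (R : realType) (F : scalar_kind) (p : \bar R)
    (u : nat -> scalars R F) : Prop :=
  match p with
  | r%:E => (\sum_(0 <= n <oo) ((modulus (u n)) `^ r)%:E < +oo)%E
  | +oo%E => (fun n => modulus (u n)) @ \oo --> (0 : R)
  | -oo%E => False
  end.

Section Dual.
Variables (K : numFieldType) (E : tvsType K).

Definition dual_pred : {pred E -> K^o} :=
  mem [set f : E -> K^o | linear f /\ continuous f].

Lemma dual_submod_closed : submod_closed dual_pred.
Proof.
split=> [|a f g].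
  rewrite inE; split=> [b x y|x]; last exact: cst_continuous.
  by rewrite /GRing.zero/= scaler0 addr0.
rewrite !inE => -[lf cf] [lg cg]; split=> [b x y|x].
  rewrite -!/((_ + _) _) !fctE /= lf lg !scalerDr !scalerA (mulrC b a).
  by rewrite addrACA.
have caf : (a *: f y : K^o) @[y --> x] --> (a *: f x : K^o).
  apply: (cvg_comp (fun y => (a, f y)) (fun z : K^o * K^o => z.1 *: z.2)).
    exact: cvg_pair (cvg_cst a) (cf x).
  exact: (@scale_continuous _ K^o (a, f x)).
apply: (cvg_comp (fun y => (a *: f y, g y)) (fun z : K^o * K^o => z.1 + z.2)).
  exact: cvg_pair caf (cg x).
exact: (@add_continuous K^o (a *: f x, g x)).
Qed.

HB.instance Definition _ :=
  GRing.isSubmodClosed.Build K (E -> K^o) dual_pred dual_submod_closed.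

Record dual := Dual {
  dual_fun :> E -> K^o;
  dual_funP : dual_fun \in dual_pred
}.

HB.instance Definition _ := [isSub for dual_fun].
HB.instance Definition _ := [Choice of dual by <:].
HB.instance Definition _ := [SubChoice_isSubLmodule of dual by <:].

Definition weak : topologicalType :=
  initial_topology
    ((fun x f => f x) : E -> prod_topology (fun _ : dual => K^o)).

End Dual.

Record topology (T : Type) := Topology {
  is_open : set_system T;
  is_openT : is_open setT;
  is_openI : setI_closed is_open;
  is_open_bigU : forall (I : Type) (f : I -> set T),
    (forall i, is_open (f i)) -> is_open (\bigcup_i f i)
}.

Definition finer (T : Type) (t t' : topology T) : Prop :=
  is_open t' `<=` is_open t.

Definition with_topology (T : Type) (t : topology T) : Type := T.

HB.instance Definition _ (K : numFieldType) (V : lmodType K) (t : topology V) :=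
  GRing.Lmodule.on (with_topology t).
HB.instance Definition _ (K : numFieldType) (V : lmodType K) (t : topology V) :=
  isOpenTopological.Build (with_topology t)
    (is_openT t) (is_openI (t := t)) (is_open_bigU (t := t)).

Record lc_topology (K : numFieldType) (V : lmodType K) := LcTopology {
  lc_top :> topology V;
  lc_add : continuous
    (fun x : with_topology lc_top * with_topology lc_top => x.1 + x.2);
  lc_scale : continuous (fun z : K^o * with_topology lc_top => z.1 *: z.2);
  lc_convex : exists2 B : set_system (with_topology lc_top),
    (forall b, b \in B -> convex_set b) & basis B
}.

Definition lcs (K : numFieldType) (V : lmodType K) (t : lc_topology V) : Type :=
  with_topology t.

HB.instance Definition _ (K : numFieldType) (V : lmodType K)
    (t : lc_topology V) := PreTopologicalLmodule.on (lcs t).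
(* The factory provides only the uniform structure of the group topology. *)
HB.instance Definition _ (K : numFieldType) (V : lmodType K)
    (t : lc_topology V) :=
  PreTopologicalLmod_isTvs.Build K (lcs t)
    (lc_add (l := t)) (lc_scale (l := t)) (lc_convex t).
HB.instance Definition _ (K : numFieldType) (V : lmodType K)
    (t : lc_topology V) :=
  PreTopologicalNmodule_isTopologicalNmodule.Build (lcs t) (lc_add (l := t)).
HB.instance Definition _ (K : numFieldType) (V : lmodType K)
    (t : lc_topology V) :=
  TopologicalNmodule_isTopologicalLmodule.Build K (lcs t) (lc_scale (l := t)).
HB.instance Definition _ (K : numFieldType) (V : lmodType K)
    (t : lc_topology V) :=
  Uniform_isTvs.Build K (lcs t) (lc_convex t).

Section Mackey.
Variables (K : numFieldType) (E : tvsType K).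

(* The topological dual of [E'] endowed with [t] is [E], embedded in the
   algebraic dual of [E'] by evaluation. *)
Definition compatible (t : lc_topology (dual E)) : Prop :=
  forall phi : lcs t -> K^o,
    (linear phi /\ continuous phi) <->
    (exists x : E, forall chi : dual E, phi chi = chi x).

(* A compatible topology is automatically Hausdorff, since the evaluations
   separate the points of [E']. *)
Definition is_mackey (t : lc_topology (dual E)) : Prop :=
  compatible t /\
  (forall t' : lc_topology (dual E), compatible t' -> finer t t').

End Mackey.

Section LocallyConvex.
Variables (K : numFieldType) (E : tvsType K).

(* The positivity of [r] matters: in [R[i]], [r <= `|t|] is false for every [t]
   when [r] is not real. *)
Definition tvs_bounded (B : set E) : Prop :=
  forall U : set E, nbhs (0 : E) U ->
    exists2 r : K, 0 < r &
      forall t : K, r <= `|t| -> B `<=` [set t *: u | u in U].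

(* The [precompact] of MathComp-Analysis means relatively compact. The
   definition uses neighborhoods of 0, because the uniform structure of a
   [tvsType] is not required to be translation invariant. *)
Definition totally_bounded (B : set E) : Prop :=
  forall U : set E, nbhs (0 : E) U ->
    exists2 S : set E, finite_set S & B `<=` \bigcup_(s in S) [set s + u | u in U].

Definition absolutely_convex (C : set E) : Prop :=
  forall (x y : E) (a b : K),
    C x -> C y -> `|a| + `|b| <= 1 -> C (a *: x + b *: y).

Definition closed_absconvex_hull (A : set E) : set E :=
  smallest [set C | closed C /\ absolutely_convex C] A.

Definition locally_complete : Prop :=
  forall x : nat -> E, x @ \oo --> (0 : E) ->
    compact (closed_absconvex_hull (range x)).

Definition relatively_weakly_compact (A : set E) : Prop :=
  compact (closure (A : set (weak E))).

End LocallyConvex.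

Definition frechet_urysohn (T : topologicalType) (A : set T) : Prop :=
  forall (S : set T) (x : T), S `<=` A -> A x -> closure S x ->
    exists2 s : nat -> T, (forall n, S (s n)) & s @ \oo --> x.

Section WeaklyP.
Variables (R : realType) (F : scalar_kind) (p : \bar R).
Variable E : tvsType (scalars R F).

Definition weakly_p_summable (x : nat -> E) : Prop :=
  forall chi : dual E, lp p (fun n => chi (x n)).

Definition weakly_p_convergent (x : nat -> E) (l : E) : Prop :=
  weakly_p_summable (fun n => x n - l).

Definition relatively_weakly_seq_p_compact (A : set E) : Prop :=
  forall x : nat -> E, (forall n, A (x n)) ->
    exists (k : nat -> nat) (l : E),
      increasing_seq k /\ weakly_p_convergent (x \o k) l.

Definition weakly_seq_p_angelic : Prop :=
  forall A : set E,
    relatively_weakly_seq_p_compact A <-> relatively_weakly_compact A.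

Definition weakly_p_angelic : Prop :=
  weakly_seq_p_angelic /\
  (forall A : set (weak E), compact A -> frechet_urysohn A).

Definition weak_star_p_summable (chi : nat -> dual E) : Prop :=
  forall x : E, lp p (fun n => chi n x).

Definition p_oo_limited (B : set E) : Prop :=
  B !=set0 /\
  (forall chi : nat -> dual E, weak_star_p_summable chi ->
    (fun n => ereal_sup [set (modulus (chi n b))%:E | b in B]) @ \oo
      --> (0 : \bar R)).

End WeaklyP.

(* Main.v *)
Require Import Defs.
From mathcomp Require Import all_boot all_order all_algebra.
From mathcomp Require Import complex.
From mathcomp Require Import all_classical all_reals all_analysis.
From mathcomp Require Import ring lra.

(** Write H for the dual E' with the Mackey topology mu; by compatibility the
dual of H is E.

Limited sets are precompact.  Every neighborhood of 0 in H contains the open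
unit ball of a continuous seminorm q, and the polar A of q, that is, the set of
points x of E with |chi(x)| <= q(chi) for all chi, is relatively weakly compact:
a limit of points of A along an ultrafilter is a linear form bounded by q, and
compatibility makes it a point of A ([polar_relatively_weakly_compact]).
Angelicity then extracts from every sequence in A a subsequence x_k that
converges weakly p-summably to some l; a (p,oo)-limited set B makes x_k - l
converge to 0 uniformly on B.  So A is totally bounded for the pseudometric
sup_B |b(x - y)|.  By Grothendieck's exchange argument B is totally bounded for
sup_A |(b - c)(x)|: on a finite net of A only finitely many scalars matter, and
these are bounded.  The bipolar theorem turns closeness on A into closeness
modulo the unit ball of q ([bipolar], [limited_totally_bounded]).

Precompact sets are limited.  A weakly p-summable sequence is weakly null, so it
suffices that each weakly null sequence of E is equicontinuous on H; a finite
net of B then gives uniform convergence on B.  The topology on E' of uniform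
convergence on weakly null sequences is shown to be compatible with the duality,
hence coarser than mu.  For this, a linear form phi with
|phi(chi)| <= sup_n |chi(z_n)|, z weakly null, is represented by the
Hahn-Banach theorem as chi |-> sum_n a_n chi(z_n) with a in l_1
([null_bounded_form_l1]), and local completeness provides the sum of the series
a_n z_n ([weakly_null_summable]): z is bounded by uniform boundedness
([weakly_null_bounded]), the factorization a_n = b_n c_n with b null and c in
l_1 makes b_n z_n a null sequence of E, and the partial sums of c_n (b_n z_n)
stay in a compact hull, where they have a cluster point. *)

Set Implicit Arguments.
Unset Strict Implicit.
Unset Printing Implicit Defensive.

Import Order.TTheory GRing.Theory Num.Theory.
Import numFieldTopology.Exports numFieldNormedType.Exports.

Local Open Scope classical_set_scope.
Local Open Scope ring_scope.

(** * Real and complex scalars *)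

Section Scalars.
Variables (R : realType) (F : scalar_kind).
Local Notation K := (scalars R F).

(** Seminorms are real-valued while scalars live in K; [emb] is the inclusion
of R in K.  Through the lemmas of this section the real and the complex case are
treated alike everywhere but in the proof of the Hahn-Banach theorem. *)
Definition emb : R -> K :=
  match F return R -> scalars R F with
  | RealScalars => fun x => x
  | ComplexScalars => fun x => (x%:C)%C
  end.

Lemma embD x y : emb (x + y) = emb x + emb y.
Proof. by rewrite /emb; case: F => //; exact: rmorphD. Qed.

Lemma embM x y : emb (x * y) = emb x * emb y.
Proof. by rewrite /emb; case: F => //; exact: rmorphM. Qed.

Lemma embN x : emb (- x) = - emb x.
Proof. by rewrite /emb; case: F => //; exact: rmorphN. Qed.

Lemma emb0 : emb 0 = 0.
Proof. by rewrite /emb; case: F. Qed.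

Lemma emb1 : emb 1 = 1.
Proof. by rewrite /emb; case: F. Qed.

Lemma emb_le x y : (emb x <= emb y) = (x <= y).
Proof. by rewrite /emb; case: F => //; exact: lecR. Qed.

Lemma emb_lt x y : (emb x < emb y) = (x < y).
Proof. by rewrite /emb; case: F => //; exact: ltcR. Qed.

Lemma normr_modulus (x : K) : `|x| = emb (modulus x).
Proof. 
by rewrite /emb /modulus; case: F x => // x; rewrite normc_def; case: x.
Qed.

Lemma emb_inj : injective emb.
Proof. by move=> x y xy; apply/eqP; rewrite eq_le -!emb_le xy lexx. Qed.

Lemma modulus_ge0 (x : K) : 0 <= modulus x.
Proof. by rewrite -emb_le -normr_modulus emb0. Qed.

Lemma modulusM (x y : K) : modulus (x * y) = modulus x * modulus y.
Proof. by apply: emb_inj; rewrite embM -!normr_modulus normrM. Qed.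

Lemma modulusD (x y : K) : modulus (x + y) <= modulus x + modulus y.
Proof. by rewrite -emb_le embD -!normr_modulus ler_normD. Qed.

Lemma modulusN (x : K) : modulus (- x) = modulus x.
Proof. by apply: emb_inj; rewrite -!normr_modulus normrN. Qed.

Lemma modulus0 : modulus (0 : K) = 0.
Proof. by apply: emb_inj; rewrite -normr_modulus normr0 emb0. Qed.

Lemma modulus1 : modulus (1 : K) = 1.
Proof. by apply: emb_inj; rewrite -normr_modulus normr1 emb1. Qed.

Lemma modulus_eq0 (x : K) : modulus x = 0 -> x = 0.
Proof. by move=> x0; apply/eqP; rewrite -normr_eq0 normr_modulus x0 emb0. Qed.

Lemma modulus_gt0 (x : K) : x != 0 -> 0 < modulus x.
Proof.
move=> x0; rewrite lt_neqAle modulus_ge0 andbT eq_sym.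
by apply: contra x0 => /eqP/modulus_eq0 ->.
Qed.

Lemma emb_neq0 x : x != 0 -> emb x != 0.
Proof. by rewrite -emb0 (inj_eq emb_inj). Qed.

Lemma modulus_emb x : modulus (emb x) = `|x|.
Proof.
case: (ger0P x) => x0; apply: emb_inj; rewrite -normr_modulus.
  by rewrite ger0_norm // -emb0 emb_le.
by rewrite embN ltr0_norm // -emb0 emb_lt.
Qed.

Lemma modulusB (x y : K) : modulus (x - y) = modulus (y - x).
Proof. by rewrite -modulusN opprB. Qed.

Lemma modulusV (x : K) : modulus x^-1 = (modulus x)^-1.
Proof.
have [->|x0] := eqVneq x 0; first by rewrite invr0 modulus0 invr0.
have m0 : modulus x != 0 by rewrite gt_eqF // modulus_gt0.
by apply: (mulfI m0); rewrite -modulusM !mulfV // modulus1.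
Qed.

Lemma gt0_emb (e : K) : 0 < e -> e = emb (modulus e) /\ 0 < modulus e.
Proof.
move=> e0; have ee : e = emb (modulus e) by rewrite -normr_modulus gtr0_norm.
by split=> //; rewrite -emb_lt -ee emb0.
Qed.

Lemma nbhs_modulus (x : K^o) (U : set K^o) :
  nbhs x U <-> exists2 e : R, 0 < e & forall y, modulus (y - x) < e -> U y.
Proof.
split=> [/nbhs_ballP[e /= e0 eU]|[e e0 eU]].
  have [ee me0] := gt0_emb e0; exists (modulus e) => // y yx.
  by apply: eU; rewrite -ball_normE /= distrC normr_modulus ee emb_lt.
apply/nbhs_ballP; exists (emb e) => /=; first by rewrite -emb0 emb_lt.
move=> y; rewrite -ball_normE /= distrC normr_modulus emb_lt; exact: eU.
Qed.

Lemma cvg_modulus (T : Type) (G : set_system T) (f : T -> K^o) (l : K^o) :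
  Filter G ->
  f @ G --> l <-> forall e, 0 < e -> \forall t \near G, modulus (f t - l) < e.
Proof.
move=> FG; split=> [fl e e0|fl U].
  by apply: (fl [set y | modulus (y - l) < e]); apply/nbhs_modulus; exists e.
move=> /nbhs_modulus[e e0 eU].
by have := fl _ e0; apply: filterS => t; exact: eU.
Qed.

(** In the complex case the compact set is a square containing the disc, the
image of a product of two segments. *)
Lemma modulus_bounded_compact (C : R) :
  exists2 A : set K^o, compact A & forall x, modulus x <= C -> A x.
Proof.
rewrite /modulus; case: F => /=.
  exists `[- C, C]%classic; first exact: segment_compact.
  by move=> x; rewrite ler_norml /= in_itv.
exists ((fun z : R * R => Complex z.1 z.2) @`
          (`[- C, C]%classic `*` `[- C, C]%classic)).
  apply: continuous_compact; last by apply: compact_setX; exact: segment_compact.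
  apply: continuous_subspaceT => -[a b] U /nbhs_ballP[e /= e0 eU].
  have [r er r0] : exists2 r : R, e = (r%:C)%C & 0 < r.
    by case: e e0 {eU} => a' b'; rewrite ltcE /= => /andP[/eqP -> ?]; exists a'.
  exists (ball a (r/2), ball b (r/2)).
    by split; apply: nbhsx_ballx; rewrite divr_gt0.
  move=> [x y] /= [xa yb]; apply: eU; rewrite -ball_normE /=.
  move: xa yb; rewrite -!ball_normE /= => xa yb.
  have -> : Complex a b - Complex x y = ((a - x)%:C + 'i * (b - y)%:C)%C.
    by simpc.
  rewrite (le_lt_trans (ler_normD _ _)) // er.
  rewrite normrM !normc_def /= !expr0n /= !add0r !addr0 expr1n sqrtr1 mul1r.
  rewrite !sqrtr_sqr.
  by rewrite -rmorphD ltcR (splitr r) ltrD.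
move=> [a b] /= ab; have C0 : 0 <= C := le_trans (sqrtr_ge0 _) ab.
exists (a, b) => //=; split; rewrite /= in_itv /= -ler_norml;
  apply: le_trans ab; rewrite -sqrtr_sqr ler_wsqrtr //.
- by rewrite lerDl sqr_ge0.
- by rewrite lerDr sqr_ge0.
Qed.

End Scalars.
Arguments emb {R F}.

(** * Seminorms and the Hahn-Banach theorem *)

Record seminorm (R : realType) (F : scalar_kind) (V : lmodType (scalars R F))
    (q : V -> R) : Prop := Seminorm {
  seminormD : forall x y, q (x + y) <= q x + q y;
  seminormZ : forall a x, q (a *: x) = modulus a * q x
}.

Section SeminormTheory.
Variables (R : realType) (F : scalar_kind) (V : lmodType (scalars R F)).
Variables (q : V -> R) (sq : seminorm q).

Lemma seminorm0 : q 0 = 0.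
Proof. by rewrite -(scale0r 0) (seminormZ sq) modulus0 mul0r. Qed.

Lemma seminormN x : q (- x) = q x.
Proof. by rewrite -scaleN1r (seminormZ sq) modulusN modulus1 mul1r. Qed.

Lemma seminorm_ge0 x : 0 <= q x.
Proof.
have := seminormD sq x (- x); rewrite subrr seminorm0 seminormN; lra.
Qed.

Lemma seminormZ_emb (t : R) x : 0 <= t -> q (emb t *: x) = t * q x.
Proof. by move=> t0; rewrite (seminormZ sq) modulus_emb ger0_norm. Qed.

End SeminormTheory.

Section HahnBanach.
Variables (R : realType) (F : scalar_kind) (V : lmodType (scalars R F)).
Variables (q : V -> R) (sq : seminorm q).

(** The graph of a real-linear form, defined on some real subspace of V and
dominated by q.  That it is the graph of a function follows from domination: if
(v, r) and (v, s) belong to it, then so does (0, r - s), whence r <= s. *)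
Definition dominated_graph (G : set (V * R)) : Prop :=
  [/\ G (0, 0),
      forall v w r s, G (v, r) -> G (w, s) -> G (v + w, r + s),
      forall t v r, G (v, r) -> G (emb t *: v, t * r)
    & forall v r, G (v, r) -> r <= q v].

(** The value c at v0 has to satisfy r - q(v - v0) <= c <= q(v + v0) - r for all
(v, r) in the graph.  Every lower bound is below every upper bound by the
triangle inequality, so the supremum of the lower bounds will do. *)
Lemma dominated_graph_step (G : set (V * R)) (v0 : V) :
  dominated_graph G ->
  exists2 B, dominated_graph B & G `<=` B /\ exists c, B (v0, c).
Proof.
move=> [G0 GD GZ Gq].
pose S := [set x | exists v r, G (v, r) /\ x = r - q (v - v0)].
have SU v r : G (v, r) -> ubound S (q (v + v0) - r).
  move=> Gv _ [w [s [Gw ->]]]; have := Gq _ _ (GD _ _ _ _ Gv Gw).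
  have := seminormD sq (v + v0) (w - v0).
  by rewrite addrACA subrr addr0; lra.
have hS : has_sup S.
  split; first by exists (0 - q (0 - v0)), 0, 0.
  by exists (q (0 + v0) - 0); exact: SU.
pose c := sup S.
have cU v r : G (v, r) -> r + c <= q (v + v0).
  move=> Gv; have : c <= q (v + v0) - r by apply: ge_sup (hS.1) (SU _ _ Gv).
  lra.
have cL v r : G (v, r) -> r - c <= q (v - v0).
  move=> Gv; have : r - q (v - v0) <= c by apply: (ub_le_sup hS.2); exists v, r.
  lra.
exists [set x | exists v r t, G (v, r) /\ x = (v + emb t *: v0, r + t * c)]; last first.
  split.
    by move=> [v r] Gv; exists v, r, 0; rewrite emb0 scale0r mul0r !addr0.
  by exists c, 0, 0, 1; rewrite emb1 scale1r mul1r !add0r.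
split.
- by exists 0, 0, 0; rewrite emb0 scale0r mul0r !addr0.
- move=> v w r s [v1 [r1 [t [Gv [-> ->]]]]] [w1 [s1 [u [Gw [-> ->]]]]].
  exists (v1 + w1), (r1 + s1), (t + u); split; first exact: GD.
  by rewrite embD scalerDl mulrDl (addrACA v1) (addrACA r1).
- move=> t v r [v1 [r1 [u [Gv [-> ->]]]]].
  exists (emb t *: v1), (t * r1), (t * u); split; first exact: GZ.
  by rewrite embM scalerDr scalerA mulrDr mulrA.
move=> v r [v1 [r1 [t [Gv [-> ->]]]]].
have [t0|t0|->] := ltgtP t 0; last first.
- by rewrite emb0 scale0r mul0r !addr0; exact: Gq.
- have := ler_wpM2l (ltW t0) (cU _ _ (GZ t^-1 _ _ Gv)).
  have -> : v1 + emb t *: v0 = emb t *: (emb t^-1 *: v1 + v0).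
    by rewrite scalerDr scalerA -embM mulfV ?gt_eqF // emb1 scale1r.
  rewrite (seminormZ_emb sq _ (ltW t0)) mulrDr mulrA mulfV ?gt_eqF //.
  by rewrite mul1r.
- have nt0 : 0 < - t by rewrite oppr_gt0.
  have := ler_wpM2l (ltW nt0) (cL _ _ (GZ (- t)^-1 _ _ Gv)).
  have -> : v1 + emb t *: v0 = emb (- t) *: (emb (- t)^-1 *: v1 - v0).
    rewrite scalerDr scalerA -embM mulfV ?gt_eqF // emb1 scale1r.
    by rewrite scalerN embN scaleNr opprK.
  rewrite (seminormZ_emb sq _ (ltW nt0)) mulrBr mulrA mulfV ?gt_eqF //.
  by rewrite mul1r mulNr opprK.
Qed.

(** Zorn's lemma for dominated graphs containing G; the empty set is added to the
ordered family so that the empty chain also has an upper bound. *)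
Lemma real_hahn_banach (G : set (V * R)) : dominated_graph G ->
  exists u : V -> R,
    [/\ forall x y, u (x + y) = u x + u y,
        forall t x, u (emb t *: x) = t * u x,
        forall x, u x <= q x
      & forall v r, G (v, r) -> u v = r].
Proof.
move=> dG.
pose P := [set A | A = set0 \/ (dominated_graph A /\ G `<=` A)].
have [|A [PA maxA]] := @Zorn_bigcup _ P.
  move=> C CP Ctot.
  have [C0|/set0P[x Cx]] := eqVneq (\bigcup_(X in C) X) set0; [by left|right].
  have good X y : C X -> X y -> dominated_graph X /\ G `<=` X.
    by move=> CX Xy; have [X0|//] := CP _ CX; rewrite X0 in Xy.
  have [X0 CX0 X0x] := Cx.
  have [[G0 _ _ _] GX0] := good _ _ CX0 X0x.
  split; last by move=> y Gy; exists X0 => //; exact: GX0.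
  split; first by exists X0.
  - move=> v w r s [X CX Xv] [Y CY Yw].
    have [[_ XD _ _] _] := good _ _ CX Xv; have [[_ YD _ _] _] := good _ _ CY Yw.
    have [XY|YX] := Ctot _ _ CX CY.
      by exists Y => //; apply: YD => //; exact: XY.
    by exists X => //; apply: XD => //; exact: YX.
  - move=> t v r [X CX Xv]; have [[_ _ XZ _] _] := good _ _ CX Xv.
    by exists X => //; exact: XZ.
  - by move=> v r [X CX Xv]; have [[_ _ _ Xq] _] := good _ _ CX Xv; exact: Xq.
have [dA GA] : dominated_graph A /\ G `<=` A.
  have [A0|//] := PA; exfalso; apply: (maxA G); last by right; split.
  rewrite A0; split; first exact: sub0set.
  by case: dG => G0 _ _ _ /(_ _ G0).
have tot v : exists r, A (v, r).
  have [B dB [AB [c Bc]]] := dominated_graph_step v dA.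
  exists c; apply: contrapT => nAc; apply: (maxA B); last by right; split=> // ? /GA /AB.
  by split=> // BA; apply: nAc; exact: BA.
have [A0 AD AZ Aq] := dA.
have uniq v r s : A (v, r) -> A (v, s) -> r = s.
  have le r' s' : A (v, r') -> A (v, s') -> r' <= s'.
    move=> Ar As; have := Aq _ _ (AD _ _ _ _ Ar (AZ (-1) _ _ As)).
    by rewrite embN emb1 scaleN1r subrr (seminorm0 sq); lra.
  by move=> Ar As; apply/eqP; rewrite eq_le !le.
have [u uA] := choice tot.
exists u; split.
- by move=> x y; apply: uniq (uA _) (AD _ _ _ _ (uA x) (uA y)).
- by move=> t x; apply: uniq (uA _) (AZ t _ _ (uA x)).
- by move=> x; exact: Aq.
- by move=> v r /GA; exact: uniq.
Qed.

End HahnBanach.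

(** The form to be extended is given by its graph G.  In the complex case the
real form u extending Re is complexified to u(v) - i u(iv); rotating v so that
the value becomes real and nonnegative turns the bound on u into a bound on the
modulus. *)
Lemma hahn_banach (R : realType) (F : scalar_kind) (V : lmodType (scalars R F))
    (q : V -> R) (G : set (V * scalars R F)) :
  seminorm q ->
  G (0, 0) ->
  (forall v w r s, G (v, r) -> G (w, s) -> G (v + w, r + s)) ->
  (forall t v r, G (v, r) -> G (t *: v, t * r)) ->
  (forall v r, G (v, r) -> modulus r <= q v) ->
  exists f : V -> (scalars R F)^o,
    [/\ linear f, forall v, modulus (f v) <= q v
      & forall v r, G (v, r) -> f v = r].
Proof.
case: F V q G => V q G sq G0 GD GZ Gq.
  have [|u [uD uZ uq uG]] := @real_hahn_banach R RealScalars V q sq G.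
    by split=> // v r /Gq; apply: le_trans; exact: ler_norm.
  exists u; split=> //; first by move=> a x y; rewrite uD; congr (_ + _); exact: uZ.
  move=> v; rewrite /modulus /= ler_norml uq andbT -(seminormN sq) lerNl.
  have -> : - u v = u (- v) by rewrite -scaleN1r (uZ (-1)) mulN1r.
  exact: uq.
pose GR := [set x : V * R | exists2 k, G (x.1, k) & x.2 = complex.Re k].
have [|u [uD uZ uq uG]] := @real_hahn_banach R ComplexScalars V q sq GR.
  split.
  - by exists 0.
  - move=> v w r s [k Gk /= ->] [l Gl /= ->]; exists (k + l); first exact: GD.
    by case: k l {Gk Gl} => ? ? [].
  - move=> t v r [k Gk /= ->]; exists (emb t * k); first exact: GZ.
    by case: k {Gk} => a b /=; rewrite mul0r subr0.
  - move=> v r [k Gk /= ->]; apply: le_trans (Gq _ _ Gk); rewrite /modulus /=.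
    case: k {Gk} => a b /=; apply: le_trans (ler_norm _) _.
    by rewrite -sqrtr_sqr ler_wsqrtr // lerDl sqr_ge0.
pose i : scalars R ComplexScalars := Complex 0 1.
pose f (v : V) : scalars R ComplexScalars := Complex (u v) (- u (i *: v)).
have fD x y : f (x + y) = f x + f y.
  by rewrite /f scalerDr !uD opprD.
have scE (a : scalars R ComplexScalars) (v : V) :
    a *: v = (emb (complex.Re a) : scalars R ComplexScalars) *: v
             + (emb (complex.Im a) : scalars R ComplexScalars) *: (i *: v).
  rewrite scalerA -scalerDl; congr (_ *: _).
  case: a => a b; apply/eqP; rewrite eq_complex /=.
  by rewrite !(mul0r, mulr0, mulr1, subr0, addr0, add0r) !eqxx.
have iiE (v : V) : i *: (i *: v) = - v.
  rewrite scalerA -scaleN1r; congr (_ *: _).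
  by apply/eqP; rewrite eq_complex /= !(mul0r, mulr0, mulr1, subr0, addr0, add0r) oppr0 !eqxx.
have uN v : u (- v) = - u v by rewrite -scaleN1r -(emb1 R ComplexScalars) -embN uZ mulN1r.
have fZ a v : f (a *: v) = a * f v.
  rewrite /f [i *: (a *: v)]scalerA [i * a]mulrC -scalerA !(scE a) iiE !uD !uZ uN.
  case: a => a b; apply/eqP; rewrite eq_complex /= /GRing.scale /=.
  by apply/andP; split; apply/eqP; ring.
exists f; split.
- by move=> a x y; rewrite fD fZ.
- move=> v; have [->|fv0] := eqVneq (modulus (f v : scalars R ComplexScalars)) 0.
    exact: seminorm_ge0.
  set m := modulus _ in fv0 *.
  have m0 : 0 < m by rewrite lt_neqAle eq_sym fv0; exact: (@modulus_ge0 R ComplexScalars).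
  pose t : scalars R ComplexScalars := emb m / f v.
  have f0 : f v != 0.
    by apply: contra fv0; rewrite /m => /eqP ->; apply/eqP; exact: (@modulus0 R ComplexScalars).
  have tf : f (t *: v) = emb m by rewrite fZ /t divfK.
  have -> : m = u (t *: v) by have /(congr1 (@complex.Re R)) := tf.
  apply: le_trans (uq _) _.
  rewrite (seminormZ sq) /t modulusM modulusV modulus_emb gtr0_norm //.
  by rewrite mulfV // mul1r.
- move=> v r Gr; rewrite /f (uG v (complex.Re r)); last by exists r.
  rewrite (uG (i *: v) (complex.Re (i * r))); last by exists (i * r) => //; exact: GZ.
  by case: r {Gr} => a b; rewrite /= mul0r mul1r sub0r opprK.
Qed.

Lemma norming_functional (R : realType) (F : scalar_kind)
    (V : lmodType (scalars R F)) (q : V -> R) (x : V) : seminorm q ->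
  exists f : V -> (scalars R F)^o,
    [/\ linear f, forall v, modulus (f v) <= q v & f x = emb (q x)].
Proof.
move=> sq.
pose G := [set z : V * scalars R F |
  exists a, z = (a *: x, a * emb (q x))].
have [||||f [lf fq fG]] := @hahn_banach R F V q G sq.
- by exists 0; rewrite scale0r mul0r.
- move=> v w r s [a [-> ->]] [b [-> ->]]; exists (a + b).
  by rewrite scalerDl mulrDl.
- by move=> t v r [a [-> ->]]; exists (t * a); rewrite scalerA mulrA.
- move=> v r [a [-> ->]]; rewrite modulusM modulus_emb (seminormZ sq).
  by rewrite ger0_norm ?seminorm_ge0.
- exists f; split=> //; apply: fG; exists 1; by rewrite scale1r mul1r.
Qed.

(** * Linear forms and their limits *)

Section LinearForms.
Variables (R : realType) (F : scalar_kind) (V : lmodType (scalars R F)).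
Variables (f : V -> (scalars R F)^o) (lf : linear f).

Lemma linear_formD x y : f (x + y) = f x + f y.
Proof. by have := lf 1 x y; rewrite !scale1r. Qed.

Lemma linear_form0 : f 0 = 0.
Proof. by apply: (addIr (f 0)); rewrite -linear_formD !add0r. Qed.

Lemma linear_formZ a x : f (a *: x) = a * f x.
Proof. by rewrite -[a *: x]addr0 lf linear_form0 addr0. Qed.

Lemma linear_formB x y : f (x - y) = f x - f y.
Proof. by rewrite linear_formD -scaleN1r linear_formZ mulN1r. Qed.

Lemma linear_form_le (q : V -> R) : seminorm q ->
  (forall x, q x < 1 -> modulus (f x) <= 1) -> forall x, modulus (f x) <= q x.
Proof.
move=> sq fq x; apply/ler_addgt0Pr => e e0.
have t0 : 0 < q x + e by have := seminorm_ge0 sq x; lra.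
have : modulus (f (emb (q x + e)^-1 *: x)) <= 1.
  apply: fq; rewrite (seminormZ_emb sq) ?invr_ge0 ?ltW //.
  by rewrite mulrC ltr_pdivrMr // mul1r ltrDl.
rewrite linear_formZ modulusM modulus_emb gtr0_norm ?invr_gt0 //.
by rewrite mulrC ler_pdivrMr // mul1r.
Qed.

End LinearForms.

Section Limits.
Variables (R : realType) (F : scalar_kind).
Local Notation K := (scalars R F).

(** The compactness behind the Banach-Alaoglu theorem: applied at each point, it
provides the pointwise limit of a pointwise bounded family of linear forms. *)
Lemma ultra_bounded_cvg (T : Type) (G : set_system T) (f : T -> K^o) (C : R) :
  UltraFilter G -> (\forall t \near G, modulus (f t) <= C) ->
  exists l : K^o, f @ G --> l.
Proof.
move=> UG fC; have [A cA CA] := modulus_bounded_compact F C.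
have /cA[l [_ cl]] : (f @ G) A by apply: filterS fC => t; exact: CA.
exists l => U lU.
have [//|Gc] := in_ultra_setVsetC (f @^-1` U) UG.
have /(_ lU)[y [nUy Uy]] := cl (~` U) U Gc; by [].
Qed.

Lemma modulus_limit_le (T : Type) (G : set_system T) (f : T -> K^o) (l a : K^o) (C : R) :
  ProperFilter G -> f @ G --> l ->
  (\forall t \near G, modulus (f t - a) <= C) -> modulus (l - a) <= C.
Proof.
move=> PG /(cvg_modulus _ _ (PG : Filter G)) fl fC.
apply/ler_addgt0Pr => e e0.
have [t [te tC]] := filter_ex (filterI (fl e e0) fC).
have -> : l - a = (l - f t) + (f t - a) by rewrite addrA subrK.
rewrite modulusB in te; apply: le_trans (modulusD _ _) _; lra.
Qed.

Lemma limit_unique (T : Type) (G : set_system T) (f : T -> K^o) (l l' : K^o) :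
  ProperFilter G -> f @ G --> l -> f @ G --> l' -> l = l'.
Proof.
move=> PG fl fl'; apply/eqP; rewrite -subr_eq0; apply/eqP/modulus_eq0/eqP.
rewrite eq_le modulus_ge0 andbT; apply/ler_addgt0Pr => e e0; rewrite add0r.
apply: (modulus_limit_le PG fl).
by move/(cvg_modulus _ _ (PG : Filter G)) : fl' => /(_ _ e0); apply: filterS => t /ltW.
Qed.

Lemma linear_limit (T : Type) (G : set_system T) (V : lmodType K)
    (f : T -> V -> K^o) (phi : V -> K^o) :
  ProperFilter G -> (forall t, linear (f t)) ->
  (forall v, (fun t => f t v) @ G --> phi v) -> linear phi.
Proof.
move=> PG lf fphi a x y.
apply: (limit_unique PG (fphi _)).
rewrite (_ : (fun t => _) = (fun t => a *: f t x + f t y)); last first.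
  by apply/funext => t; rewrite lf.
have cafx : (fun t => a *: f t x : K^o) @ G --> (a *: phi x : K^o).
  apply: (cvg_comp (fun t => (a, f t x)) (fun z : K^o * K^o => z.1 *: z.2)).
    exact: cvg_pair (cvg_cst a) (fphi x).
  exact: (@scale_continuous _ K^o (a, phi x)).
apply: (cvg_comp (fun t => (a *: f t x, f t y)) (fun z : K^o * K^o => z.1 + z.2)).
  exact: cvg_pair cafx (fphi y).
exact: (@add_continuous K^o (a *: phi x, phi y)).
Qed.

End Limits.

(** * Gauges and continuous seminorms *)

Section Gauge.
Variables (R : realType) (F : scalar_kind) (V : lmodType (scalars R F)).
Variable D : set V.
Hypothesis D_convex : forall s t x y, 0 <= s -> 0 <= t -> s + t = 1 ->
  D x -> D y -> D (emb s *: x + emb t *: y).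
Hypothesis D_balanced : forall a x, modulus a <= 1 -> D x -> D (a *: x).
Hypothesis D_absorbing : forall x, exists2 t : R, 0 < t & D (emb t^-1 *: x).

(** The Minkowski functional of D. *)
Definition gauge (x : V) : R := inf [set t | 0 < t /\ D (emb t^-1 *: x)].

Let gauge_has_inf x : has_inf [set t : R | 0 < t /\ D (emb t^-1 *: x)].
Proof.
split; first by have [t t0 tx] := D_absorbing x; exists t.
by exists 0 => t [/ltW].
Qed.

Lemma gauge_le t x : 0 < t -> D (emb t^-1 *: x) -> gauge x <= t.
Proof. by move=> t0 Dx; apply: ge_inf (gauge_has_inf x).2 _ _. Qed.

Lemma gauge_lt x s : gauge x < s -> exists t, [/\ 0 < t, t < s & D (emb t^-1 *: x)].
Proof.
move=> xs; have e0 : 0 < s - gauge x by rewrite subr_gt0.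
have [t [t0 Dt] ts] := inf_adherent e0 (gauge_has_inf x).
by exists t; split=> //; move: ts; rewrite -/(gauge x) addrC subrK.
Qed.

Lemma gauge_seminorm : seminorm gauge.
Proof.
have D0 : D 0.
  have [t _ tx] := D_absorbing 0; by rewrite scaler0 in tx.
have ge0 x : 0 <= gauge x.
  by apply: lb_le_inf; [exact: (gauge_has_inf x).1|move=> t [/ltW]].
have Zle a x : a != 0 -> gauge (a *: x) <= modulus a * gauge x.
  move=> a0; have m0 := modulus_gt0 a0.
  rewrite mulrC -ler_pdivrMr //; apply/ler_addgt0Pr => e e0.
  have /gauge_lt[t [t0 te Dt]] : gauge x < gauge x + e by rewrite ltrDl.
  apply: le_trans (ltW te); rewrite ler_pdivrMr //.
  apply: gauge_le; first by rewrite mulr_gt0.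
  have -> : emb (t * modulus a)^-1 *: (a *: x) =
      (emb (modulus a)^-1 * a) *: (emb t^-1 *: x).
    by rewrite invfM embM !scalerA -mulrA mulrC.
  apply: D_balanced => //.
  by rewrite modulusM modulus_emb ger0_norm ?invr_ge0 ?modulus_ge0 // mulVf ?gt_eqF.
have q0 : gauge 0 = 0.
  apply/eqP; rewrite eq_le ge0 andbT; apply/ler_addgt0Pr => e e0; rewrite add0r.
  by apply: gauge_le => //; rewrite scaler0.
split=> [x y|a x].
  apply/ler_addgt0Pr => e e0.
  have /gauge_lt[s [s0 se Ds]] : gauge x < gauge x + e / 2 by rewrite ltrDl divr_gt0.
  have /gauge_lt[t [t0 te Dt]] : gauge y < gauge y + e / 2 by rewrite ltrDl divr_gt0.
  have st0 : 0 < s + t by rewrite addr_gt0.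
  apply: (@le_trans _ _ (s + t)); last by lra.
  apply: gauge_le => //.
  have -> : emb (s + t)^-1 *: (x + y) =
      emb (s / (s + t)) *: (emb s^-1 *: x) + emb (t / (s + t)) *: (emb t^-1 *: y).
    rewrite !scalerA -!embM scalerDr.
    by congr (emb _ *: _ + emb _ *: _); field; rewrite !gt_eqF.
  apply: D_convex => //; try by rewrite divr_ge0 ?ltW.
  by rewrite -mulrDl mulfV ?gt_eqF.
have [->|a0] := eqVneq a 0; first by rewrite scale0r q0 modulus0 mul0r.
apply/eqP; rewrite eq_le Zle //=.
have m0 := modulus_gt0 a0.
rewrite -ler_pdivlMl // -modulusV.
apply: le_trans (Zle _ _ _); last by rewrite invr_eq0.
by rewrite scalerA mulVf // scale1r.
Qed.

End Gauge.

Section ContinuousSeminorms.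
Variables (R : realType) (F : scalar_kind).
Local Notation K := (scalars R F).
Variable E : tvsType K.

Definition continuous_seminorm (q : E -> R) : Prop :=
  seminorm q /\ nbhs (0 : E) [set x | q x < 1].

Lemma continuous_seminorm_ball (q : E -> R) (e : R) :
  continuous_seminorm q -> 0 < e -> nbhs (0 : E) [set x | q x < e].
Proof.
move=> [sq q1] e0; 
have ne0 : (emb e : K) != 0 by rewrite emb_neq0 ?gt_eqF.
have := nbhs0Z ne0 q1; apply: filterS => _ [x /= x1 <-].
by rewrite (seminormZ_emb sq _ (ltW e0)) gtr_pMr.
Qed.

Lemma bounded_form_continuous (q : E -> R) (f : E -> K^o) :
  continuous_seminorm q -> linear f -> (forall x, modulus (f x) <= q x) ->
  continuous f.
Proof.
move=> cq lf fq x; apply/cvg_modulus => e e0.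
have := nbhsT x (continuous_seminorm_ball cq e0); apply: filterS => _ [y /= ye <-].
by rewrite linear_formD // addrC addKr; apply: le_lt_trans ye.
Qed.

Lemma convex_neighborhood (U : set E) : nbhs (0 : E) U ->
  exists C : set E, [/\ nbhs (0 : E) C, C `<=` U &
    forall s t x y, 0 <= s -> 0 <= t -> s + t = 1 ->
      C x -> C y -> C (emb s *: x + emb t *: y)].
Proof.
move=> U0; have [B Bc [Bo Bn]] := @locally_convex _ E.
have [C [BC C0] CU] := Bn 0 U U0.
exists C; split=> //; first by apply: open_nbhs_nbhs; split=> //; exact: Bo.
move=> s t x y s0 t0 st Cx Cy.
have s0K : 0 <= emb s :> K by rewrite -(emb0 R F) emb_le.
have s1K : emb s <= 1 :> K by rewrite -(emb1 R F) emb_le; lra.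
have := Bc C (mem_set BC) x y (Itv01 s0K s1K) (mem_set Cx) (mem_set Cy).
have -> : emb t = 1 - emb s :> K by rewrite -(emb1 R F) -embN -embD -st addrC addKr.
by rewrite inE.
Qed.

(** A convex neighborhood C of 0 need not be balanced; its balanced core, the set
of the x with a x in C for all |a| <= 1, is still a neighborhood of 0 because
scalar multiplication is continuous at (0, 0), and q is its gauge. *)
Lemma neighborhood_seminorm (U : set E) : nbhs (0 : E) U ->
  exists2 q, continuous_seminorm q & forall x, q x < 1 -> U x.
Proof.
move=> /convex_neighborhood[C [C0 CU Cc]].
pose D := [set x : E | forall a, modulus a <= 1 -> C (a *: x)].
have D0 : nbhs (0 : E) D.
  have := @scale_continuous _ E (0, 0) C; rewrite /= scaler0 => /(_ C0).
  move=> [[B1 B2] /= [/nbhs_modulus[e e0 eB1] B20] BC].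
  have e2 : 0 < e / 2 by rewrite divr_gt0.
  have ne : (emb (e / 2) : K) != 0 by rewrite emb_neq0 ?gt_eqF.
  have := nbhs0Z ne B20; apply: filterS => _ [x B2x <-] a a1.
  rewrite scalerA; apply: (BC (_, _)); split=> //=; apply: eB1.
  rewrite subr0 modulusM modulus_emb gtr0_norm //.
  by apply: le_lt_trans (ler_piMl (ltW e2) a1) _; lra.
have Dc s t x y : 0 <= s -> 0 <= t -> s + t = 1 ->
    D x -> D y -> D (emb s *: x + emb t *: y).
  move=> s0 t0 st Dx Dy a a1; rewrite scalerDr !(scalerA a) !(mulrC a) -!(scalerA _ a).
  by apply: Cc => //; [exact: Dx|exact: Dy].
have Db a x : modulus a <= 1 -> D x -> D (a *: x).
  move=> a1 Dx b b1; rewrite scalerA; apply: Dx.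
  by rewrite modulusM; apply: mulr_ile1 => //; exact: modulus_ge0.
have Da x : exists2 t : R, 0 < t & D (emb t^-1 *: x).
  have := @scale_continuous _ E (0, x) D; rewrite /= scale0r => /(_ D0).
  move=> [[B1 B2] /= [/nbhs_modulus[e e0 eB1] B2x] BD].
  exists (e / 2)^-1; first by rewrite invr_gt0 divr_gt0.
  apply: (BD (_, _)); split=> //=; last exact: nbhs_singleton.
  by apply: eB1; rewrite subr0 modulus_emb invrK gtr0_norm; lra.
exists (gauge D); last first.
  move=> x /(gauge_lt Da)[t [t0 t1 Dx]]; apply: CU.
  have := Dx (emb t); rewrite modulus_emb gtr0_norm // => /(_ (ltW t1)).
  by rewrite scalerA -embM mulfV ?gt_eqF // emb1 scale1r.
split; first exact: gauge_seminorm.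
have ne : (emb 2^-1 : K) != 0 by rewrite emb_neq0 ?invr_eq0 ?pnatr_eq0.
have := nbhs0Z ne D0; apply: filterS => _ [x Dx <-] /=.
apply: (@le_lt_trans _ _ 2^-1); last by lra.
apply: gauge_le => //; rewrite ?invr_gt0 //.
by rewrite scalerA -embM mulVf ?emb1 ?scale1r // invr_eq0 pnatr_eq0.
Qed.

End ContinuousSeminorms.

Section DualTheory.
Variables (R : realType) (F : scalar_kind).
Local Notation K := (scalars R F).
Variable E : tvsType K.
Implicit Types chi psi : dual E.

Lemma dual_linear chi : linear chi.
Proof. by have := dual_funP chi; rewrite inE => -[]. Qed.

Lemma dual_continuous chi : continuous chi.
Proof. by have := dual_funP chi; rewrite inE => -[]. Qed.

Lemma dual_of_form (f : E -> K^o) : linear f -> continuous f ->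
  exists chi : dual E, forall x, chi x = f x.
Proof.
move=> lf cf; have fP : f \in @dual_pred K E by rewrite inE.
by exists (Dual fP).
Qed.

Lemma dualD chi psi x : (chi + psi) x = chi x + psi x.
Proof. by []. Qed.

Lemma dualZ a chi x : (a *: chi) x = a * chi x.
Proof. by []. Qed.

Lemma dualB chi psi x : (chi - psi) x = chi x - psi x.
Proof. by []. Qed.

Lemma eval_linear (x : E) : linear (fun chi : dual E => chi x : K^o).
Proof. by move=> a chi psi; rewrite dualD dualZ. Qed.

Lemma dual_ball chi (e : R) : 0 < e -> nbhs (0 : E) [set x | modulus (chi x) < e].
Proof.
move=> e0; have /cvg_modulus /(_ _ e0) := @dual_continuous chi 0.
by apply: filterS => x /=; rewrite (linear_form0 (dual_linear chi)) subr0.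
Qed.

End DualTheory.

(** * Finite nets *)

Section FiniteNets.

(** Without a finite net one could choose points of A one after the other, none of
them close to an earlier one. *)
Lemma finite_net (T : choiceType) (A : set T) (close : T -> T -> Prop) :
  (forall x : nat -> T, (forall n, A (x n)) ->
     exists m n, (m < n)%N /\ close (x m) (x n)) ->
  exists s : seq T, (forall y, y \in s -> A y) /\
    forall x, A x -> exists2 y, y \in s & close y x.
Proof.
move=> h; apply: contrapT => noNet.
have next (s : seq T) : exists y, (forall z, z \in s -> A z) ->
    A y /\ forall z, z \in s -> ~ close z y.
  have [sA|nsA] := pselect (forall z, z \in s -> A z).
    apply: contrapT => /forallNP nx; apply: noNet; exists s; split=> // x Ax.
    apply: contrapT => nex; apply: (nx x) => _; split=> // z zs zx.
    by apply: nex; exists z.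
  have [[y _]|T0] := pselect (exists y : T, True); first by exists y.
  by exfalso; apply: noNet; exists [::]; split=> // x; case: T0; exists x.
have [nx nxP] := choice next.
pose L := fix L n := if n is n'.+1 then nx (L n') :: L n' else [::].
have LA n : forall z, z \in L n -> A z.
  elim: n => [//|n IH] z; rewrite /= inE => /orP[/eqP ->|/IH //].
  by have [] := nxP _ IH.
have LL m n : (m < n)%N -> nx (L m) \in L n.
  elim: n => [//|n IH]; rewrite ltnS leq_eqVlt => /orP[/eqP ->|/IH mn].
    by rewrite /= mem_head.
  by rewrite /= inE mn orbT.
have [m [n [mn]]] := h (fun n => nx (L n)) (fun n => (nxP _ (LA n)).1).
exact: (nxP _ (LA n)).2 _ (LL _ _ mn).
Qed.

Lemma near_forall_seq (T : Type) (G : set_system T) (X : eqType)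
    (P : T -> X -> Prop) (s : seq X) : Filter G ->
  (forall x, x \in s -> \forall t \near G, P t x) ->
  \forall t \near G, forall x, x \in s -> P t x.
Proof.
move=> FG; elim: s => [|x s IH] sP; first by apply: nearW.
have /IH Gs : forall y, y \in s -> \forall t \near G, P t y.
  by move=> y ys; apply: sP; rewrite inE ys orbT.
have Gx := sP x (mem_head _ _).
apply: filterS (filterI Gx Gs) => t [tx ts] y; rewrite inE => /orP[/eqP ->//|].
exact: ts.
Qed.

(** Along a free ultrafilter the sequence converges at every x of s; two indices
taken from one member of the ultrafilter then serve for all of s. *)
Lemma bounded_sequence_close_terms (R : realType) (F : scalar_kind) (X : eqType)
    (b : nat -> X -> scalars R F) (s : seq X) (e : R) : 0 < e ->
  (forall x, x \in s -> exists C, forall n, modulus (b n x) <= C) ->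
  exists m n, (m < n)%N /\ forall x, x \in s -> modulus (b m x - b n x) < e.
Proof.
move=> e0 sC.
have [G [UG GN]] := @ultraFilterLemma nat \oo _.
have /choice[phi phiP] : forall x, exists l : scalars R F, x \in s ->
    \forall n \near G, modulus (b n x - l) < e / 2.
  move=> x.
  have [/sC[C bC]|_] := boolP (x \in s); last by exists 0.
  have [|l bl] := @ultra_bounded_cvg R F nat G (fun n => b n x) C UG.
    by apply: nearW => n; exact: bC.
  exists l => _; have /cvg_modulus := bl; apply.
  by rewrite divr_gt0.
have Gs : \forall n \near G, forall x, x \in s -> modulus (b n x - phi x) < e / 2.
  exact: near_forall_seq.
have [m ms] := filter_ex Gs.
have Gm : G [set n | (m < n)%N] by apply: GN; exists m.+1.
have [n [mn ns]] := filter_ex (filterI Gm Gs).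
exists m, n; split=> // x xs.
have -> : b m x - b n x = (b m x - phi x) + (phi x - b n x) by rewrite addrA subrK.
apply: le_lt_trans (modulusD _ _) _; rewrite (modulusB (phi x)).
by rewrite [e]splitr ltrD ?ms ?ns.
Qed.

End FiniteNets.

(** * Polars of neighborhoods in a compatible topology *)

Section WeakTopology.
Variables (R : realType) (F : scalar_kind).
Local Notation K := (scalars R F).
Variable E : tvsType K.

Lemma weak_cvg (G : set_system (weak E)) (x : weak E) : Filter G ->
  (forall chi : dual E, (fun y : weak E => chi y : K^o) @ G --> (chi x : K^o)) ->
  G --> x.
Proof.
move=> FG Gx A [_ [[B Bop <-] Bx BA]].
pose ev : weak E -> prod_topology (fun _ : dual E => K^o) := fun y chi => chi y.
have evG : ev @ G --> ev x.
  apply/cvg_sup => chi U [V] [[W] oW <-] WV VU.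
  apply: filterS VU _; apply: (Gx chi W).
  by apply: open_nbhs_nbhs; split.
apply: filterS BA _; apply: (evG B).
by apply: open_nbhs_nbhs; split.
Qed.

Lemma weak_ball (chi : dual E) (x : weak E) (e : R) : 0 < e ->
  nbhs x [set y : weak E | modulus (chi y - chi x) < e].
Proof.
move=> e0.
pose ev : weak E -> prod_topology (fun _ : dual E => K^o) := fun y chi => chi y.
have := @initial_continuous _ _ ev x.
move=> /(_ (proj chi @^-1` [set k : K^o | modulus (k - chi x) < e])); apply.
apply: (@proj_continuous {classic dual E} (fun=> K^o) chi (ev x)).
by apply/nbhs_modulus; exists e.
Qed.

End WeakTopology.

Section CompatibleTopology.
Variables (R : realType) (F : scalar_kind).
Local Notation K := (scalars R F).
Variables (E : tvsType K) (mu : lc_topology (dual E)).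
Hypothesis mu_compat : compatible mu.

(** When q is the gauge of a neighborhood of 0 in E', this is the usual polar of
that neighborhood, a subset of E. *)
Definition polar (q : dual E -> R) : set E :=
  [set x | forall chi : dual E, modulus (chi x) <= q chi].

Lemma compatible_bounded_eval (q : lcs mu -> R) (phi : lcs mu -> K^o) :
  continuous_seminorm q -> linear phi -> (forall chi, modulus (phi chi) <= q chi) ->
  exists2 x, polar q x & forall chi : dual E, phi chi = chi x.
Proof.
move=> cq lphi phiq.
have [x phix] := (mu_compat phi).1 (conj lphi (bounded_form_continuous cq lphi phiq)).
by exists x => // chi; rewrite -phix.
Qed.

(** The Alaoglu-Bourbaki theorem.  An ultrafilter on the polar converges pointwise
on E' to a linear form bounded by q; it is by compatibility that this form is
the evaluation at a point of E. *)
Lemma polar_relatively_weakly_compact (q : lcs mu -> R) :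
  continuous_seminorm q -> relatively_weakly_compact (polar q).
Proof.
move=> cq; rewrite /relatively_weakly_compact compact_ultra => G UG GA.
have clA : closure (polar q : set (weak E)) `<=` (polar q : set (weak E)).
  move=> x clx chi; apply/ler_addgt0Pr => e e0.
  have [y [yA yx]] := clx _ (weak_ball chi x e0).
  have -> : chi x = (chi x - chi y) + chi y by rewrite subrK.
  apply: le_trans (modulusD _ _) _; rewrite modulusB addrC.
  by apply: lerD (yA chi) (ltW yx).
have /choice[phi Gphi] : forall chi : lcs mu, exists l : K^o,
    (fun y : weak E => (chi : dual E) y : K^o) @ G --> l.
  move=> chi; apply: (@ultra_bounded_cvg _ _ _ _ _ (q chi)).
  by apply: filterS GA => y /clA; exact.
have lphi : linear phi.
  by apply: (@linear_limit R F _ G (lcs mu) (fun (y : weak E) (chi : lcs mu) => (chi : dual E) y)).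
have phiq chi : modulus (phi chi) <= q chi.
  rewrite -[phi chi]subr0; apply: (modulus_limit_le _ (Gphi chi)).
  by apply: filterS GA => y /clA /(_ chi); rewrite subr0.
have [x qx phix] := compatible_bounded_eval cq lphi phiq.
exists x; split; first exact: subset_closure.
by apply: weak_cvg => chi; rewrite -phix; exact: Gphi.
Qed.

(** A functional phi with phi(chi) = q(chi) and |phi| <= q is the evaluation at a
point of the polar. *)
Lemma bipolar (q : lcs mu -> R) (chi : dual E) : continuous_seminorm q ->
  (forall x, polar q x -> modulus (chi x) < 1) -> q chi < 1.
Proof.
move=> cq chi1; have [phi [lphi phiq phichi]] := norming_functional (chi : lcs mu) cq.1.
have [x qx phix] := compatible_bounded_eval cq lphi phiq.
have := chi1 x qx; rewrite -phix phichi modulus_emb ger0_norm //.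
exact: seminorm_ge0 cq.1 _.
Qed.

Lemma eval_dual (x : E) : exists f : dual (lcs mu), forall chi : dual E, f chi = chi x.
Proof.
have [|l c] := (mu_compat (fun chi : lcs mu => (chi : dual E) x)).2; first by exists x.
exact: (dual_of_form l c).
Qed.

Lemma bounded_pointwise (B : set (lcs mu)) (x : E) : tvs_bounded B ->
  exists C : R, forall b, B b -> modulus ((b : dual E) x) <= C.
Proof.
move=> bB; have [f fx] := eval_dual x.
have [r r0 Br] := bB _ (dual_ball f (@ltr01 R)).
have rr : r <= `|r| by rewrite gtr0_norm.
exists (modulus r) => b /(Br r rr)[c /= c1 <-].
rewrite dualZ modulusM -fx; apply: ler_piMr (ltW c1); exact: modulus_ge0.
Qed.

End CompatibleTopology.

(** * Limited sets are precompact *)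

Section Limited.
Variables (R : realType) (F : scalar_kind) (p : \bar R).
Local Notation K := (scalars R F).
Variables (E : tvsType K) (mu : lc_topology (dual E)).
Hypothesis mu_compat : compatible mu.

(** By compatibility a weakly p-summable sequence of E is a weak* p-summable
sequence in the dual of E'. *)
Lemma limited_uniform_null (B : set (lcs mu)) (x : nat -> E) (e : R) : 0 < e ->
  p_oo_limited p B -> weakly_p_summable p x ->
  \forall n \near \oo, forall b, B b -> modulus ((b : dual E) (x n)) < e.
Proof.
move=> e0 [_ limB] xp.
have [f fx] := choice (fun n => eval_dual mu_compat (x n)).
have fp : weak_star_p_summable p f.
  move=> chi; rewrite (_ : (fun n => _) = (fun n => (chi : dual E) (x n))) //.
  by apply/funext => n; rewrite fx.
have /(limB f fp) : nbhs (0 : \bar R) [set y | (y < e%:E)%E].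
  by apply: open_nbhs_nbhs; split; [exact: open_ereal_lt_ereal|rewrite /= lte_fin].
move=> [N _ hN]; exists N => // n /hN /= fe b Bb; rewrite -fx -lte_fin; apply: le_lt_trans fe.
by apply: (@ereal_sup_ubound R); exists b.
Qed.

(** Grothendieck's exchange argument.  The polar of a neighborhood of 0 has a
finite net s for the distance sup_B |b(x) - b(y)|, and B has a finite net s' for
the values on s; an arbitrary x in the polar is compared with s for two
functionals, so the three errors 1/4 add up to less than 1. *)
Lemma limited_totally_bounded (B : set (lcs mu)) :
  (forall A : set E, relatively_weakly_compact A ->
     relatively_weakly_seq_p_compact p A) ->
  tvs_bounded B -> p_oo_limited p B -> totally_bounded B.
Proof.
move=> angelic bB limB U /neighborhood_seminorm[q cq qU].
have e8 : 0 < 8^-1 :> R by rewrite invr_gt0.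
have e4 : 0 < 4^-1 :> R by rewrite invr_gt0.
have [|s [sA snet]] := @finite_net E (polar q)
  (fun x y => forall b, B b -> modulus ((b : dual E) x - (b : dual E) y) <= 4^-1).
  move=> x xA; have [k [l [kinc xl]]] :=
    angelic _ (polar_relatively_weakly_compact mu_compat cq) x xA.
  (* Both terms are within 1/8 of the weak limit l, uniformly on B. *)
  have [N _ hN] := limited_uniform_null e8 limB xl.
  exists (k N), (k N.+1); split.
    by rewrite ltnNge; have := kinc N.+1 N; rewrite leEnat => ->; rewrite ltnn.
  move=> b Bb; have := hN N (leqnn N) b Bb; have := hN N.+1 (leqnSn N) b Bb.
  rewrite /= !(linear_formB (dual_linear (b : dual E))) => h1 h2.
  have -> : (b : dual E) (x (k N)) - (b : dual E) (x (k N.+1)) =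
    ((b : dual E) (x (k N)) - (b : dual E) l) + ((b : dual E) l - (b : dual E) (x (k N.+1))).
    by rewrite addrA subrK.
  apply: le_trans (modulusD _ _) _; rewrite modulusB in h1; lra.
have [|s' [sB snet']] := @finite_net (lcs mu) B
  (fun b c => forall x, x \in s -> modulus ((b : dual E) x - (c : dual E) x) < 4^-1).
  move=> b bB'; apply: (@bounded_sequence_close_terms R F E (fun n x => (b n : dual E) x)) => //.
  move=> x xs; have [C BC] := bounded_pointwise mu_compat x bB.
  by exists C => n; exact: BC.
exists [set` s']; first exact: finite_seq.
move=> b Bb; have [c cs cb] := snet' b Bb; exists c => //.
exists (b - c); last by rewrite addrC subrK.
apply/qU/(bipolar mu_compat cq) => x /snet[y ys yx].
have h1 := yx b Bb; have h2 := yx c (sB c cs); have h3 := cb y ys.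
rewrite dualB.
have -> : (b : dual E) x - (c : dual E) x = ((b : dual E) x - (b : dual E) y) +
   (((b : dual E) y - (c : dual E) y) + ((c : dual E) y - (c : dual E) x)).
  by rewrite (addrA ((b : dual E) y - (c : dual E) y)) subrK addrA subrK.
have := modulusD ((b : dual E) x - (b : dual E) y)
  (((b : dual E) y - (c : dual E) y) + ((c : dual E) y - (c : dual E) x)).
have := modulusD ((b : dual E) y - (c : dual E) y) ((c : dual E) y - (c : dual E) x).
by rewrite modulusB in h1; rewrite modulusB in h3; lra.
Qed.

End Limited.

(** * Weakly null sequences are bounded *)

Section WeaklyNull.
Variables (R : realType) (F : scalar_kind).
Local Notation K := (scalars R F).

(** For finite p each term is dominated by the corresponding tail of the series. *)
Lemma lp_null (p : \bar R) (u : nat -> K) (e : R) : (1 <= p)%E -> lp p u -> 0 < e ->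
  \forall n \near \oo, modulus (u n) < e.
Proof.
case: p => [r|_ u0 e0|//]; last exact: (cvgr_lt _ u0).
rewrite lee_fin => r1 us e0; have r0 : 0 < r by apply: lt_le_trans r1.
have f0 k : (0%R <= (modulus (u k) `^ r)%:E)%E by rewrite lee_fin powR_ge0.
have tail0 := @nneseries_tail_cvg R _ xpredT us (fun k _ => f0 k).
have /tail0[N _ hN] : nbhs (0 : \bar R) [set y | (y < (e `^ r)%:E)%E].
  apply: open_nbhs_nbhs; split; first exact: open_ereal_lt_ereal.
  by rewrite /= lte_fin powR_gt0.
exists N => // n /hN /= ne; rewrite ltNge; apply/negP => eun.
have : ((modulus (u n) `^ r)%:E < (e `^ r)%:E)%E.
  apply: le_lt_trans ne.
  have := @nneseries_lim_ge R (fun k => (modulus (u k) `^ r)%:E) xpredT n n.+1 (fun k _ _ => f0 k).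
  by rewrite big_nat1.
rewrite lte_fin ltNge; apply/negP; rewrite negbK.
by apply: ge0_ler_powR => //; rewrite ?nnegrE ?modulus_ge0 // ltW.
Qed.

Lemma eventually_bounded (u : nat -> R) (C : R) :
  (\forall n \near \oo, u n <= C) -> exists C', forall n, u n <= C'.
Proof.
move=> [N _ hN]; elim: N C hN => [|N IH] C hN; first by exists C => n; exact: hN.
apply: (IH (Num.max C (u N))) => n /=; rewrite leq_eqVlt le_max => /orP[/eqP ->|Nn].
  by rewrite lexx orbT.
by rewrite hN.
Qed.

Variable E : tvsType K.

Definition weakly_null (x : nat -> E) : Prop :=
  forall chi : dual E, (fun n => chi (x n)) @ \oo --> (0 : K^o).

Lemma weakly_nullP (x : nat -> E) : weakly_null x <->
  forall (chi : dual E) e, 0 < e -> \forall n \near \oo, modulus (chi (x n)) < e.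
Proof.
split=> h chi; first move=> e e0.
  have /cvg_modulus /(_ e e0) := h chi.
  by apply: filterS => n; rewrite subr0.
apply/cvg_modulus => e e0; have := h chi e e0.
by apply: filterS => n; rewrite subr0.
Qed.

Lemma weakly_null_pointwise_bounded (x : nat -> E) (chi : dual E) :
  weakly_null x -> exists C, forall n, modulus (chi (x n)) <= C.
Proof.
move=> /weakly_nullP /(_ chi 1 ltr01) h; apply: (@eventually_bounded _ 1).
by apply: filterS h => n /ltW.
Qed.

(** Uniform boundedness by a gliding hump.  If q(x_n) is unbounded, choose N_k
with c_k q(x_(N_k)) > k, where c_k = 4^-(k+1), and psi_k with
|psi_k| <= q and psi_k(x_(N_k)) = q(x_(N_k)).  One of phi_k + c_k psi_k, phi_k - c_k psi_k
has modulus at least c_k q(x_(N_k)) at x_(N_k); call it phi_(k+1).  Later steps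
change this value by at most a third of it, so the limit of the phi_k is a
continuous form that is unbounded on the sequence. *)
Lemma weakly_null_bounded (x : nat -> E) (q : E -> R) :
  weakly_null x -> continuous_seminorm q -> exists C, forall n, q (x n) <= C.
Proof.
move=> x0 cq; have sq := cq.1; apply: contrapT => unb.
pose c k : R := 4^-1 ^+ k.+1.
have c0 k : 0 < c k by rewrite exprn_gt0 // invr_gt0.
have cS k : c k.+1 = c k / 4 by rewrite /c exprS mulrC.
have /choice[N Nk] : forall k, exists n, k%:R / c k < q (x n).
  move=> k; apply: contrapT => /forallNP h; apply: unb; exists (k%:R / c k) => n.
  by rewrite leNgt; apply/negP; exact: h.
have /choice[psi psiP] := fun k => norming_functional (x (N k)) sq.
pose add k (f : E -> K^o) (s : K) : E -> K^o := fun v => f v + s * (emb (c k) * psi k v).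
pose step k (f : E -> K^o) :=
  if `[< c k * q (x (N k)) <= modulus (add k f 1 (x (N k))) >]
  then add k f 1 else add k f (- 1).
pose phi := fix phi k : E -> K^o := if k is k'.+1 then step k' (phi k') else fun=> 0.
have stepE k f : exists2 s : K, modulus s = 1 & step k f = add k f s.
  rewrite /step; case: ifP => _; first by exists 1; rewrite ?modulus1.
  by exists (- 1); rewrite ?modulusN ?modulus1.
have lphi k : linear (phi k).
  elim: k => [|k IH] a u v; first by rewrite /= scaler0 addr0.
  rewrite /=; have [s _ ->] := stepE k (phi k).
  have [lpsi _ _] := psiP k.
  rewrite /add (linear_formD IH) (linear_formZ IH) (linear_formD lpsi) (linear_formZ lpsi).
  by rewrite /GRing.scale /=; ring.
have phiS k v : modulus (phi k.+1 v - phi k v) <= c k * q v.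
  rewrite /=; have [s s1 ->] := stepE k (phi k); have [_ psiq _] := psiP k.
  rewrite /add addrC addKr !modulusM s1 mul1r modulus_emb gtr0_norm //.
  by rewrite ler_pM2l.
have phiD m k v : modulus (phi (m + k)%N v - phi m v) <= 4 / 3 * (c m - c (m + k)%N) * q v.
  elim: k => [|k IH]; first by rewrite addn0 !subrr modulus0 mulr0 mul0r.
  rewrite addnS.
  have -> : phi (m + k).+1 v - phi m v =
    (phi (m + k).+1 v - phi (m + k)%N v) + (phi (m + k)%N v - phi m v).
    by rewrite addrA subrK.
  apply: le_trans (modulusD _ _) _; have := phiS (m + k)%N v; rewrite cS.
  set t := c (m + k)%N in IH *; move: IH; set a := modulus _; set b := modulus _.
  move=> h1 h2; have -> : 4 / 3 * (c m - t / 4) * q v = t * q v + 4 / 3 * (c m - t) * q v by field.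
  exact: lerD.
have phi_tail m j v : (m <= j)%N -> modulus (phi j v - phi m v) <= 4 / 3 * c m * q v.
  move=> mj; have := phiD m (j - m)%N v; rewrite subnKC //.
  move/le_trans; apply; apply: ler_wpM2r; first exact: seminorm_ge0.
  by have := c0 j; lra.
(* Half the difference of the two candidates is c_k psi_k, so they cannot both be
   smaller than c_k q at x_(N_k). *)
have phi_big k : c k * q (x (N k)) <= modulus (phi k.+1 (x (N k))).
  rewrite /= /step; case: asboolP => // /negP; rewrite -ltNge => lt1.
  have [_ _ psiN] := psiP k.
  set z := x (N k) in lt1 psiN *.
  have := modulusB (add k (phi k) 1 z) (add k (phi k) (- 1) z).
  have := modulusD (add k (phi k) 1 z) (- add k (phi k) (- 1) z).
  have -> : add k (phi k) 1 z - add k (phi k) (- 1) z = emb (2 * (c k * q z)).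
    rewrite /add psiN -embM.
    have -> : 2 * (c k * q z) = c k * q z + c k * q z by ring.
    by rewrite embD; ring.
  have q0 := seminorm_ge0 sq z; have ck := c0 k.
  have cq0 : 0 <= c k * q z by rewrite mulr_ge0 // ltW.
  rewrite modulusN modulus_emb ger0_norm; last by rewrite mulr_ge0.
  by move=> h _; lra.
have [G [UG GN]] := @ultraFilterLemma nat \oo _.
have G_ge m : G [set j | (m <= j)%N] by apply: GN; exists m.
have /choice[phi' phi'P] : forall v, exists l : K^o, (fun j => phi j v : K^o) @ G --> l.
  move=> v; apply: (@ultra_bounded_cvg _ _ _ _ _ (4 / 3 * c 0%N * q v)).
  by apply: nearW => j; have := phi_tail 0%N j v (leq0n j); rewrite subr0.
have lphi' : linear phi' by exact: (linear_limit _ lphi phi'P).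
have phi'_tail m v : modulus (phi' v - phi m v) <= 4 / 3 * c m * q v.
  apply: (modulus_limit_le _ (phi'P v)).
  by apply: filterS (G_ge m) => j; exact: phi_tail.
have phi'q v : modulus (phi' v) <= q v.
  have := phi'_tail 0%N v; rewrite subr0 => /le_trans; apply.
  by rewrite ler_piMl ?seminorm_ge0 // /c expr1; lra.
have [chi chiE] := dual_of_form lphi' (bounded_form_continuous cq lphi' phi'q).
have [C chiC] := weakly_null_pointwise_bounded chi x0.
(* At x_(N_k) the limit has modulus at least 2/3 of c_k q(x_(N_k)), hence more than
   2/3 k. *)
have [k kC] : exists k : nat, 3 / 2 * C < k%:R.
  by exists (Num.truncn (3 / 2 * C)).+1; exact: truncnS_gt.
have := chiC (N k); rewrite chiE.
have h1 := phi_big k; have h2 := phi'_tail k.+1 (x (N k)).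
have h3 := Nk k; rewrite ltr_pdivrMr // mulrC in h3.
have h4 := modulusD (phi k.+1 (x (N k)) - phi' (x (N k))) (phi' (x (N k))).
rewrite subrK modulusB in h4.
have e4 : 4 / 3 * c k.+1 * q (x (N k)) = (c k * q (x (N k))) / 3 by rewrite cS; field.
rewrite e4 in h2.
move: h1 h2 h3 h4; set A := c k * q _; set B := modulus (phi k.+1 _).
by move=> *; lra.
Qed.

End WeaklyNull.

(** * Summing l_1 combinations of weakly null sequences *)

Section SummableCombinations.
Variables (R : realType) (F : scalar_kind).
Local Notation K := (scalars R F).

(** With r_n the n-th tail of the series of the |a_i|, take b_n = 2 sqrt(r_n).
Then |a_n| = r_n - r_(n+1) <= 2 sqrt(r_n) (sqrt(r_n) - sqrt(r_(n+1))), so that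
the |c_n| are dominated by a telescoping series.  When r_n = 0 the term a_n
vanishes, and so does the quotient c_n. *)
Lemma l1_factorization (a : nat -> K) (C : R) :
  (forall n, \sum_(i < n) modulus (a i) <= C) ->
  exists (b : nat -> R) (c : nat -> K),
    [/\ forall n, 0 <= b n,
        forall e, 0 < e -> \forall n \near \oo, b n < e,
        forall n, a n = emb (b n) * c n
      & forall n, \sum_(i < n) modulus (c i) <= Num.sqrt C].
Proof.
move=> aC; pose S n := \sum_(i < n) modulus (a i).
have hS : has_sup (range S) by split; [exists (S 0%N), 0%N|exists C => _ [n _ <-]; exact: aC].
pose r n := sup (range S) - S n.
have r0 n : 0 <= r n by rewrite subr_ge0; apply: (ub_le_sup hS.2); exists n.
have SS n : S n.+1 = S n + modulus (a n) by rewrite /S big_ord_recr.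
have rS n : r n - r n.+1 = modulus (a n) by rewrite /r SS; ring.
have rC : r 0%N <= C.
  rewrite /r /S big_ord0 subr0; apply: ge_sup hS.1 _ => _ [n _ <-]; exact: aC.
have rdecr n m : (n <= m)%N -> r m <= r n.
  elim: m => [|m IH]; first by rewrite leqn0 => /eqP ->.
  rewrite leq_eqVlt => /orP[/eqP ->//|/IH h]; apply: le_trans h.
  by rewrite -subr_ge0 rS modulus_ge0.
exists (fun n => 2 * Num.sqrt (r n)), (fun n => a n / emb (2 * Num.sqrt (r n))).
have sq n : Num.sqrt (r n) ^+ 2 = r n by rewrite sqr_sqrtr.
split.
- by move=> n; rewrite mulr_ge0 ?sqrtr_ge0.
- move=> e e0; have e2 : 0 < (e / 2) ^+ 2 by rewrite exprn_gt0 // divr_gt0.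
  have [_ [N _ <-] SN] := sup_adherent e2 hS.
  exists N => // n /= Nn.
  have rn : r n < (e / 2) ^+ 2 by apply: le_lt_trans (rdecr _ _ Nn) _; rewrite /r; lra.
  have : Num.sqrt (r n) < e / 2.
    by rewrite -(@ltr_pXn2r _ 2) ?nnegrE ?sqrtr_ge0 ?sq // divr_ge0 // ltW.
  by lra.
- move=> n; have [s0|s0] := eqVneq (Num.sqrt (r n)) 0.
    rewrite s0 mulr0 emb0 mul0r; apply: modulus_eq0; apply/eqP.
    rewrite eq_le modulus_ge0 andbT -rS; have := r0 n.+1.
    by have := sq n; rewrite s0 expr0n /=; lra.
  by rewrite mulrC divfK // emb_neq0 // mulf_neq0 // pnatr_eq0.
move=> n; suff : \sum_(i < n) modulus (a i / emb (2 * Num.sqrt (r i)))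
    <= Num.sqrt (r 0%N) - Num.sqrt (r n).
  have := sqrtr_ge0 (r n); have := ler_wsqrtr rC; lra.
elim: n => [|n IH]; first by rewrite big_ord0 subrr.
rewrite big_ord_recr /=.
suff : modulus (a n / emb (2 * Num.sqrt (r n))) <= Num.sqrt (r n) - Num.sqrt (r n.+1) by lra.
have le1 := ler_wsqrtr (rdecr _ _ (leqnSn n)).
rewrite modulusM modulusV modulus_emb ger0_norm ?mulr_ge0 ?sqrtr_ge0 //.
have [s0|s0] := eqVneq (Num.sqrt (r n)) 0.
  by rewrite {1}s0 mulr0 invr0 mulr0 subr_ge0.
have sp : 0 < Num.sqrt (r n) by rewrite lt_neqAle eq_sym s0 sqrtr_ge0.
rewrite ler_pdivrMr ?mulr_gt0 // -rS -{1}sq -{1}[r n.+1]sq.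
move: le1 sp (sqrtr_ge0 (r n.+1)).
set x := Num.sqrt (r n); set y := Num.sqrt (r n.+1) => xy x0 y0.
have : (x - y) * (x + y) <= (x - y) * (2 * x) by apply: ler_wpM2l; lra.
by lra.
Qed.

Variable E : tvsType K.

(** The induction shows that the sum is s w with w in C and s the sum of the
|c_i|; the bound s <= 1 enters only at the end. *)
Lemma absolutely_convex_sum (C : set E) (y : nat -> E) (c : nat -> K) (n : nat) :
  absolutely_convex C -> (forall i, C (y i)) ->
  \sum_(i < n) modulus (c i) <= 1 -> C (\sum_(i < n) c i *: y i).
Proof.
move=> cC Cy; pose s n := \sum_(i < n) modulus (c i).
have cCR u v (a b : K) : C u -> C v -> modulus a + modulus b <= 1 -> C (a *: u + b *: v).
  move=> Cu Cv ab; apply: cC => //.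
  by rewrite !normr_modulus -embD -(emb1 R F) emb_le.
have s0 m : 0 <= s m by rewrite sumr_ge0 // => i _; exact: modulus_ge0.
have [w Cw ->] : exists2 w, C w & \sum_(i < n) c i *: y i = emb (s n) *: w.
  elim: n => [|n [w Cw IH]]; first by exists (y 0%N); rewrite // /s !big_ord0 emb0 scale0r.
  have sS : s n.+1 = s n + modulus (c n) by rewrite /s big_ord_recr.
  rewrite big_ord_recr /= IH.
  have [sz|snz] := eqVneq (s n.+1) 0.
    exists w => //; rewrite sz; have := s0 n; have := modulus_ge0 (c n) => m0 sn0.
    have -> : s n = 0 by lra.
    have -> : c n = 0 by apply: modulus_eq0; lra.
    by rewrite !emb0 !scale0r addr0.
  have sp : 0 < s n.+1 by rewrite lt_neqAle eq_sym snz s0.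
  have Knz : emb (s n.+1) != 0 :> K by rewrite emb_neq0.
  exists ((emb (s n) / emb (s n.+1)) *: w + (c n / emb (s n.+1)) *: y n).
    apply: cCR => //; rewrite !modulusM !modulusV !modulus_emb !ger0_norm //.
    by rewrite -mulrDl -sS mulfV.
  by rewrite scalerDr !scalerA !(mulrC (emb (s n.+1))) !divfK.
rewrite -/(s n) => sn1; have := cCR w w (emb (s n)) 0 Cw Cw.
by rewrite scale0r addr0; apply; rewrite modulus0 addr0 modulus_emb ger0_norm.
Qed.

(** Write a_n = b_n c_n with b null and c in l_1.  Since x is bounded, b_n x_n is
a null sequence of E, whose closed absolutely convex hull is compact and
contains the partial sums of c_n (b_n x_n); any cluster point is the weak sum. *)
Lemma weakly_null_summable (x : nat -> E) (a : nat -> K) (L : dual E -> K^o) :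
  locally_complete E -> weakly_null x ->
  (forall n, \sum_(i < n) modulus (a i) <= 1) ->
  (forall chi : dual E, (fun n => \sum_(i < n) a i * chi (x i) : K^o) @ \oo --> L chi) ->
  exists y : E, forall chi : dual E, L chi = chi y.
Proof.
move=> lcE x0 a1 aL.
have [b [c [b0 bn ab c1]]] := l1_factorization a1; rewrite sqrtr1 in c1.
pose z n := emb (b n) *: x n.
have z0 : z @ \oo --> (0 : E).
  move=> U /neighborhood_seminorm[q cq qU].
  have [C xC] := weakly_null_bounded x0 cq.
  have C0 : 0 <= C by apply: le_trans (xC 0%N); exact: seminorm_ge0 cq.1 _.
  have /bn[N _ hN] : 0 < (C + 1)^-1 by rewrite invr_gt0; lra.
  exists N => // n /hN /= bn1; apply: qU; rewrite (seminormZ_emb cq.1 _ (b0 n)).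
  apply: le_lt_trans (ler_wpM2l (b0 n) (xC n)) _.
  apply: (@le_lt_trans _ _ (b n * (C + 1))); first by apply: ler_wpM2l => //; lra.
  by rewrite -ltr_pdivlMr ?div1r //; lra.
pose s n := \sum_(i < n) c i *: z i.
have sH n : closed_absconvex_hull (range z) (s n).
  move=> C [[_ cC] zC]; apply: (absolutely_convex_sum cC) => // i; apply: zC.
  by exists i.
have sHoo : (s @ \oo) (closed_absconvex_hull (range z)) by exists 0%N => // n _; exact: sH.
have [y [_ ycl]] := lcE _ z0 (s @ \oo) _ sHoo.
exists y => chi.
have chis n : chi (s n) = \sum_(i < n) a i * chi (x i).
  rewrite /s; elim: n => [|n IH].
    by rewrite !big_ord0 (linear_form0 (dual_linear chi)).
  rewrite !big_ord_recr /= (linear_formD (dual_linear chi)) IH; congr (_ + _).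
  by rewrite !(linear_formZ (dual_linear chi)) ab mulrA [c n * _]mulrC.
apply/eqP; rewrite -subr_eq0; apply/eqP/modulus_eq0/eqP.
rewrite eq_le modulus_ge0 andbT; apply/ler_addgt0Pr => e e0; rewrite add0r.
have e2 : 0 < e / 2 by rewrite divr_gt0.
have /cvg_modulus /(_ _ e2)[N _ hN] := aL chi.
have /cvg_modulus /(_ _ e2) yU := @dual_continuous _ _ _ chi y.
have sN : (s @ \oo) [set s n | n in [set n | (N <= n)%N]] by exists N => // n Nn; exists n.
have [_ [[n /hN /= h1 <-]]] := ycl _ _ sN yU; rewrite /= chis.
rewrite modulusB in h1; move=> h2.
have -> : L chi - chi y = (L chi - \sum_(i < n) a i * chi (x i)) +
  (\sum_(i < n) a i * chi (x i) - chi y) by rewrite addrA subrK.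
by apply: le_trans (modulusD _ _) _; lra.
Qed.

End SummableCombinations.

(** * Locally convex topologies from directed families of seminorms *)

Section SeminormTopology.
Variables (R : realType) (F : scalar_kind) (V : lmodType (scalars R F)).
Local Notation K := (scalars R F).
Variable P : set (V -> R).
Hypothesis P_seminorm : forall q, P q -> seminorm q.
Hypothesis P_nonempty : P !=set0.
Hypothesis P_directed : forall q1 q2, P q1 -> P q2 ->
  exists2 q, P q & forall x, q1 x <= q x /\ q2 x <= q x.
Hypothesis P_scale : forall q (c : R), P q -> 0 < c ->
  exists2 q', P q' & forall x, c * q x <= q' x.

Definition seminorm_open (O : set V) : Prop :=
  forall x, O x -> exists2 q, P q & forall y, q (y - x) < 1 -> O y.

Lemma seminorm_openT : seminorm_open setT.
Proof. by move=> x _; have [q Pq] := P_nonempty; exists q. Qed.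

Lemma seminorm_openI : setI_closed seminorm_open.
Proof.
move=> A B oA oB x [/oA[q1 P1 h1] /oB[q2 P2 h2]].
have [q Pq h] := P_directed P1 P2; exists q => // y qy.
by split; [apply: h1|apply: h2]; apply: le_lt_trans qy; have [] := h (y - x).
Qed.

Lemma seminorm_open_bigU (I : Type) (f : I -> set V) :
  (forall i, seminorm_open (f i)) -> seminorm_open (\bigcup_i f i).
Proof.
move=> of_ x [i _ /of_[q Pq h]]; exists q => // y /h fy; by exists i.
Qed.

Definition seminorm_top : topology V :=
  Topology seminorm_openT seminorm_openI seminorm_open_bigU.

Lemma seminorm_ball_open (q : V -> R) (x : V) :
  P q -> seminorm_open [set y | q (y - x) < 1].
Proof.
move=> Pq y /= yx; have d0 : 0 < 1 - q (y - x) by rewrite subr_gt0.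
have ci : 0 < (1 - q (y - x))^-1 by rewrite invr_gt0.
have [q' Pq' qq'] := P_scale Pq ci; exists q' => // z zy /=.
have := le_lt_trans (qq' _) zy; rewrite mulrC ltr_pdivrMr // mul1r => h.
have -> : z - x = (z - y) + (y - x) by rewrite addrA subrK.
by apply: le_lt_trans (seminormD (P_seminorm Pq) _ _) _; lra.
Qed.

Lemma seminorm_nbhs (x : with_topology seminorm_top) (U : set V) :
  nbhs x U <-> exists2 q, P q & forall y : V, q (y - x) < 1 -> U y.
Proof.
rewrite nbhsE; split=> [[A [oA Ax] AU]|[q Pq h]].
  have [q Pq h] := (oA : seminorm_open A) x Ax.
  by exists q => // y /h; exact: AU.
exists [set y : V | q (y - x) < 1]; last by move=> y /h.
split; first exact: (@seminorm_ball_open q x Pq).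
by rewrite /= subrr (seminorm0 (P_seminorm Pq)).
Qed.

Lemma seminorm_top_add : continuous
  (fun x : with_topology seminorm_top * with_topology seminorm_top => x.1 + x.2).
Proof.
move=> [x y] U /seminorm_nbhs[q Pq qU].
have [q' Pq' qq'] := P_scale Pq (@ltr0n R 2).
exists ([set z | q' (z - x) < 1], [set z | q' (z - y) < 1]).
  by split; apply/seminorm_nbhs; exists q'.
move=> [u v] [/= ux vy]; apply: qU.
have -> : u + v - (x + y) = (u - x) + (v - y) by rewrite opprD addrACA.
have h1 := le_lt_trans (qq' _) ux; have h2 := le_lt_trans (qq' _) vy.
by apply: le_lt_trans (seminormD (P_seminorm Pq) _ _) _; lra.
Qed.

(** b y - a x = b (y - x) + (b - a) x; the first term is below 1/2 because q' is at
least 2 (|a| + 1) q, the second one because of the choice of d. *)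
Lemma seminorm_top_scale : continuous
  (fun z : K^o * with_topology seminorm_top => z.1 *: z.2).
Proof.
move=> [a x] U /seminorm_nbhs[q Pq qU]; have sq := P_seminorm Pq.
have ma := modulus_ge0 a; have qx := seminorm_ge0 sq x.
have c0 : 0 < 2 * (modulus a + 1) by lra.
have [q' Pq' qq'] := P_scale Pq c0.
pose d := Num.min 1 (2 * (q x + 1))^-1.
have d0 : 0 < d by rewrite lt_min ltr01 invr_gt0; lra.
exists ([set b | modulus (b - a) < d], [set y | q' (y - x) < 1]).
  by split; [apply/nbhs_modulus; exists d|apply/seminorm_nbhs; exists q'].
move=> [b y] [/= ba yx]; apply: qU.
have -> : b *: y - a *: x = b *: (y - x) + (b - a) *: x.
  by rewrite scalerBr scalerBl addrA subrK.
apply: le_lt_trans (seminormD sq _ _) _; rewrite !(seminormZ sq).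
move: ba; rewrite lt_min => /andP[ba1 baq].
have mb : modulus b <= modulus a + 1.
  have := modulusD (b - a) a; rewrite subrK; lra.
have h1 := le_lt_trans (qq' _) yx.
have h2 : modulus b * q (y - x) <= (modulus a + 1) * q (y - x).
  by apply: ler_wpM2r => //; exact: (seminorm_ge0 sq).
have h3 : modulus (b - a) * q x <= 2^-1.
  apply: (@le_trans _ _ ((2 * (q x + 1))^-1 * q x)).
    by apply: ler_wpM2r => //; exact: ltW.
  by rewrite invfM -mulrA ler_piMr ?invr_ge0 // mulrC ler_pdivrMr; lra.
have : modulus b * q (y - x) < 2^-1 by lra.
by lra.
Qed.

Lemma seminorm_top_convex : exists2 B : set_system (with_topology seminorm_top),
  (forall b, b \in B -> convex_set b) & basis B.
Proof.
exists [set O | exists q x, P q /\ O = [set y : V | q (y - x) < 1]].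
  move=> b; rewrite inE => -[q [x [Pq ->]]] u v l; rewrite !inE /= => ux vx.
  have sq := P_seminorm Pq.
  have [t [t0 t1 lt]] : exists t : R, [/\ 0 <= t, t <= 1 & l%:num = emb t :> K].
    have l0 : 0 <= l%:num :> K by [].
    have l1 : l%:num <= 1 :> K by [].
    have le : l%:num = emb (modulus (l%:num : K)) :> K.
      by rewrite -normr_modulus ger0_norm.
    exists (modulus (l%:num : K)); split=> //; first exact: modulus_ge0.
    by rewrite -(emb_le F) -le emb1.
  suff : q (emb t *: u + (1 - emb t) *: v - x) < 1 by rewrite -lt.
  have -> : emb t *: u + (1 - emb t) *: v - x =
      emb t *: (u - x) + emb (1 - t) *: (v - x).
    rewrite embD embN emb1 !scalerBr addrACA -opprD -scalerDl.
    by rewrite [emb t + _]addrC subrK scale1r.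
  apply: le_lt_trans (seminormD sq _ _) _.
  rewrite !(seminormZ_emb sq) ?subr_ge0 //.
  have [->|tn] := eqVneq t 0; first by rewrite mul0r add0r subr0 mul1r.
  have tp : 0 < t by rewrite lt_neqAle eq_sym tn.
  apply: (@lt_le_trans _ _ (t * 1 + (1 - t) * q (v - x))).
    by rewrite ltrD2r ltr_pM2l.
  have : (1 - t) * q (v - x) <= (1 - t) * 1 by apply: ler_wpM2l; rewrite ?subr_ge0 // ltW.
  by lra.
split; first by move=> O [q [x [Pq ->]]]; exact: seminorm_ball_open.
move=> x U /seminorm_nbhs[q Pq qU].
exists [set y : V | q (y - x) < 1]; last by move=> y /qU.
split; first by exists q, x.
by rewrite /= subrr (seminorm0 (P_seminorm Pq)).
Qed.

Definition seminorm_lc_topology : lc_topology V :=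
  LcTopology seminorm_top_add seminorm_top_scale seminorm_top_convex.

Lemma seminorm_lc_continuous (q : V -> R) : P q ->
  continuous_seminorm (q : lcs seminorm_lc_topology -> R).
Proof.
move=> Pq; split.
  by split=> [x y|a x]; [exact: (seminormD (P_seminorm Pq))|exact: (seminormZ (P_seminorm Pq))].
by apply/seminorm_nbhs; exists q => // y; rewrite subr0.
Qed.

Lemma seminorm_lc_bounded (phi : lcs seminorm_lc_topology -> K^o) :
  linear phi -> continuous phi ->
  exists2 q, P q & forall x, modulus (phi x) <= q x.
Proof.
move=> lphi cphi; have /cvg_modulus/(_ 1 ltr01) := cphi 0.
move=> /seminorm_nbhs[q Pq qphi]; exists q => //.
have [sq _] := seminorm_lc_continuous Pq.
apply: (linear_form_le lphi sq) => x x1; apply: ltW.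
by have := qphi x; rewrite !subr0 (linear_form0 lphi) subr0; exact.
Qed.

End SeminormTopology.

Section SupSeminorm.
Variables (R : realType) (F : scalar_kind) (V : lmodType (scalars R F)).
Local Notation K := (scalars R F).
Variable ell : nat -> V -> K^o.
Hypothesis ell_linear : forall n, linear (ell n).
Hypothesis ell_bounded : forall v, exists C, forall n, modulus (ell n v) <= C.

Definition sup_seminorm (v : V) : R := sup (range (fun n => modulus (ell n v))).

Lemma sup_seminorm_ge n v : modulus (ell n v) <= sup_seminorm v.
Proof.
apply: ub_le_sup; last by exists n.
by have [C vC] := ell_bounded v; exists C => _ [m _ <-].
Qed.

Lemma sup_seminorm_le C v : (forall n, modulus (ell n v) <= C) -> sup_seminorm v <= C.
Proof.
move=> vC; apply: ge_sup; first by exists (modulus (ell 0%N v)), 0%N.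
by move=> _ [m _ <-].
Qed.

Lemma sup_seminormP : seminorm sup_seminorm.
Proof.
have Zle a v : sup_seminorm (a *: v) <= modulus a * sup_seminorm v.
  apply: sup_seminorm_le => n; rewrite linear_formZ // modulusM.
  by apply: ler_wpM2l; [exact: modulus_ge0|exact: sup_seminorm_ge].
split=> [u v|a v].
  apply: sup_seminorm_le => n; rewrite linear_formD //.
  by apply: le_trans (modulusD _ _) _; apply: lerD; exact: sup_seminorm_ge.
apply/eqP; rewrite eq_le Zle /=; have [->|a0] := eqVneq a 0.
  rewrite modulus0 mul0r; apply: le_trans (sup_seminorm_ge 0%N _).
  exact: modulus_ge0.
have m0 := modulus_gt0 a0.
rewrite -ler_pdivlMl // -modulusV; apply: le_trans (Zle _ _).
by rewrite scalerA mulVf // scale1r.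
Qed.

End SupSeminorm.

(** * Uniform convergence on weakly null sequences *)

Section NullSequenceTopology.
Variables (R : realType) (F : scalar_kind).
Local Notation K := (scalars R F).
Variable E : tvsType K.

Definition null_seminorm (z : nat -> E) : dual E -> R :=
  sup_seminorm (fun n (chi : dual E) => chi (z n) : K^o).

(** The family is directed because two weakly null sequences can be interleaved,
and it contains the modulus of every evaluation because a sequence with one
nonzero term is weakly null. *)
Definition null_seminorms : set (dual E -> R) :=
  [set q | exists2 z, weakly_null z & q = null_seminorm z].

Lemma null_seminorm_ge (z : nat -> E) (chi : dual E) n : weakly_null z ->
  modulus (chi (z n)) <= null_seminorm z chi.
Proof.
move=> z0; apply: (sup_seminorm_ge (ell := fun n (chi : dual E) => chi (z n) : K^o)).
by move=> psi; exact: weakly_null_pointwise_bounded.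
Qed.

Lemma null_seminorms_seminorm q : null_seminorms q -> seminorm q.
Proof.
move=> [z z0 ->]; apply: sup_seminormP; first by move=> n; exact: eval_linear.
by move=> chi; exact: weakly_null_pointwise_bounded.
Qed.

Lemma weakly_null_single (x : E) : weakly_null (fun n => if n is 0%N then x else 0).
Proof.
apply/weakly_nullP => chi e e0; exists 1%N => // -[//|n] _.
by rewrite (linear_form0 (dual_linear chi)) modulus0.
Qed.

Lemma null_seminorms_nonempty : null_seminorms !=set0.
Proof.
have z0 := weakly_null_single 0; exists (null_seminorm (fun n => if n is 0%N then 0 else 0)).
exact: (ex_intro2 _ _ _ z0 erefl).
Qed.

Lemma null_seminorms_directed q1 q2 : null_seminorms q1 -> null_seminorms q2 ->
  exists2 q, null_seminorms q & forall chi, q1 chi <= q chi /\ q2 chi <= q chi.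
Proof.
move=> [z1 z10 ->] [z2 z20 ->].
pose z n := if odd n then z2 n./2 else z1 n./2.
have z0 : weakly_null z.
  apply/weakly_nullP => chi e e0.
  have [N1 _ h1] := (weakly_nullP z1).1 z10 chi e e0.
  have [N2 _ h2] := (weakly_nullP z2).1 z20 chi e e0.
  exists (maxn N1 N2).*2 => // n /= Nn.
  have : (maxn N1 N2 <= n./2)%N by rewrite -[X in (X <= _)%N]doubleK half_leq.
  rewrite geq_max => /andP[n1 n2]; rewrite /z; case: ifP => _; [exact: h2|exact: h1].
exists (null_seminorm z); first by exists z.
move=> chi; split; apply: sup_seminorm_le => n.
- have := null_seminorm_ge chi n.*2 z0; by rewrite /z odd_double doubleK.
- have := null_seminorm_ge chi n.*2.+1 z0.
  by rewrite /z /= odd_double /= uphalf_double.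
Qed.

Lemma weakly_null_scale (c : R) (z : nat -> E) : 0 < c -> weakly_null z ->
  weakly_null (fun n => emb c *: z n).
Proof.
move=> c0 /weakly_nullP z0; apply/weakly_nullP => chi e e0.
have := z0 chi (e / c) (divr_gt0 e0 c0); apply: filterS => n.
rewrite (linear_formZ (dual_linear chi)) modulusM modulus_emb gtr0_norm //.
by rewrite ltr_pdivlMr // mulrC.
Qed.

Lemma null_seminorms_scale q (c : R) : null_seminorms q -> 0 < c ->
  exists2 q', null_seminorms q' & forall chi, c * q chi <= q' chi.
Proof.
move=> [z z0 ->] c0; have cz0 := weakly_null_scale c0 z0.
exists (null_seminorm (fun n => emb c *: z n)); first by exists (fun n => emb c *: z n).
move=> chi; rewrite mulrC -ler_pdivlMr //; apply: sup_seminorm_le => n.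
rewrite ler_pdivlMr // mulrC; have := null_seminorm_ge chi n cz0.
by rewrite (linear_formZ (dual_linear chi)) modulusM modulus_emb gtr0_norm.
Qed.

Definition null_topology : lc_topology (dual E) :=
  seminorm_lc_topology null_seminorms_seminorm null_seminorms_nonempty
    null_seminorms_directed null_seminorms_scale.

(** On pairs (chi, s), with s a polynomial seen as a finitely supported sequence,
consider the seminorm sup_n |chi(z_n) + s_n|, which extends the bound on phi
from the subspace s = 0.  If f is a Hahn-Banach extension of phi, put
a_n = f(0, 'X^n).  Testing f on unimodular coefficients gives sum |a_n| <= 1;
evaluating it at chi, paired with the polynomial of coefficients - chi(z_i) for
i < n, leaves only the values chi(z_k) with k >= n, which are small because z is
weakly null. *)
Lemma null_bounded_form_l1 (z : nat -> E) (phi : dual E -> K^o) :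
  weakly_null z -> linear phi ->
  (forall chi, modulus (phi chi) <= null_seminorm z chi) ->
  exists a : nat -> K, (forall n, \sum_(i < n) modulus (a i) <= 1) /\
    forall chi : dual E, (fun n => \sum_(i < n) a i * chi (z i) : K^o) @ \oo --> phi chi.
Proof.
move=> z0 lphi phiz.
pose V := (dual E * {poly K})%type.
pose ell n (v : V) : K^o := v.1 (z n) + v.2`_n.
have ell_lin n : linear (ell n).
  move=> a v w; rewrite /ell.
  have -> : (a *: v + w).1 = a *: v.1 + w.1 by [].
  have -> : (a *: v + w).2 = a *: v.2 + w.2 by [].
  by rewrite dualD dualZ coefD coefZ /GRing.scale /=; ring.
have ell_bdd v : exists C, forall n, modulus (ell n v) <= C.
  have [C zC] := weakly_null_pointwise_bounded v.1 z0.
  apply: (@eventually_bounded _ _ C); exists (size v.2) => // n /= vn.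
  by rewrite /ell (nth_default _ vn) addr0.
pose Q := sup_seminorm ell.
pose G := [set vr : V * K | exists chi, vr = ((chi, 0), phi chi)].
have [||||f [lf fQ fG]] := @hahn_banach R F V Q G (sup_seminormP ell_lin ell_bdd).
- by exists 0; rewrite (linear_form0 lphi).
- move=> v w r s [chi [-> ->]] [psi [-> ->]]; exists (chi + psi).
  by rewrite (linear_formD lphi); congr (_, _); congr (_, _); rewrite addr0.
- move=> t v r [chi [-> ->]]; exists (t *: chi).
  by rewrite (linear_formZ lphi); congr (_, _); congr (_, _); rewrite scaler0.
- move=> v r [chi [-> ->]]; apply: le_trans (phiz chi) _.
  apply: sup_seminorm_le => n.
  have := sup_seminorm_ge ell_bdd n (chi, 0).
  by rewrite /ell /= coef0 addr0.
pose a n := f ((0 : dual E), 'X^n).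
have f_poly n (t : nat -> K) : f (0, \poly_(i < n) t i) = \sum_(i < n) t i * a i.
  rewrite poly_def; elim: n => [|n IH]; first by rewrite !big_ord0 (linear_form0 lf).
  rewrite !big_ord_recr /= -IH /a -(linear_formZ lf) -(linear_formD lf).
  congr f; congr (_, _).
  by change ((0 : dual E) = 0 + t n *: 0); rewrite scaler0 addr0.
exists a; split=> [n|chi].
  (* t_i is the unimodular number that turns a_i into |a_i|, and 0 if a_i = 0. *)
  pose t i := emb (modulus (a i)) / a i.
  have := fQ (0, \poly_(i < n) t i); rewrite f_poly.
  have -> : \sum_(i < n) t i * a i = emb (\sum_(i < n) modulus (a i)).
    elim: n => [|n IH]; first by rewrite !big_ord0 emb0.
    rewrite !big_ord_recr /= IH embD; congr (_ + _); rewrite /t.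
    by have [->|an] := eqVneq (a n) 0; [rewrite mulr0 modulus0 emb0|rewrite divfK].
  rewrite modulus_emb ger0_norm ?sumr_ge0 // => [|i _]; last exact: modulus_ge0.
  move/le_trans; apply; apply: sup_seminorm_le => k.
  rewrite /ell /= add0r coef_poly; case: ifP => _; last by rewrite modulus0.
  rewrite /t modulusM modulusV modulus_emb ger0_norm ?modulus_ge0 //.
  have [->|an] := eqVneq (modulus (a k)) 0; first by rewrite mul0r.
  by rewrite mulfV.
apply/cvg_modulus => e e0.
have e2 : 0 < e / 2 by rewrite divr_gt0.
have [N _ hN] := (weakly_nullP z).1 z0 chi _ e2.
exists N => // n /= Nn; apply: (@le_lt_trans _ _ (e / 2)); last by lra.
have -> : \sum_(i < n) a i * chi (z i) - phi chi =
    - f (chi, - \poly_(i < n) chi (z i)).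
  have -> : (chi, - \poly_(i < n) chi (z i)) =
      (chi, 0) - (0, \poly_(i < n) chi (z i)) :> V.
    by congr (_, _); rewrite /= ?subr0 ?sub0r.
  rewrite (linear_formB lf) f_poly (fG _ (phi chi)); last by exists chi.
  rewrite opprB; congr (_ - _); apply: eq_bigr => i _; exact: mulrC.
rewrite modulusN; apply: le_trans (fQ _) _; apply: sup_seminorm_le => k.
rewrite /ell /= coefN coef_poly; case: ltnP => nk; first by rewrite subrr modulus0 ltW.
by rewrite subr0 ltW // hN //=; exact: leq_trans nk.
Qed.

Lemma null_topology_compatible : locally_complete E -> compatible null_topology.
Proof.
move=> lcE phi; split=> [[lphi cphi]|[x phix]].
  have [q [z z0 ->] phiz] := seminorm_lc_bounded lphi cphi.
  have [a [a1 aphi]] := null_bounded_form_l1 z0 lphi phiz.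
  exact: (weakly_null_summable lcE z0 a1 aphi).
have lphi : linear phi by move=> a chi psi; rewrite !phix; exact: eval_linear.
split=> //; have z0 := weakly_null_single x.
apply: (bounded_form_continuous _ lphi).
  apply: seminorm_lc_continuous; exists (fun n => if n is 0%N then x else 0) => //.
by move=> chi; rewrite phix; exact: (null_seminorm_ge chi 0%N z0).
Qed.

(** The topology of uniform convergence on weakly null sequences is compatible,
hence coarser than mu: weakly null sequences of E are equicontinuous on E'. *)
Lemma mackey_null_neighborhood (mu : lc_topology (dual E)) (x : nat -> E) (e : R) :
  locally_complete E -> is_mackey mu -> weakly_null x -> 0 < e ->
  nbhs (0 : lcs mu) [set chi : dual E | forall n, modulus (chi (x n)) < e].
Proof.
move=> lcE [_ mu_fine] x0 e0; have ei : 0 < e^-1 by rewrite invr_gt0.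
have z0 := weakly_null_scale ei x0; set z := fun n => _ in z0.
have qz : null_seminorms (null_seminorm z) by exists z.
pose O := [set chi : dual E | null_seminorm z (chi - 0) < 1].
have Oopen : @open (lcs mu) O.
  apply: (mu_fine _ (null_topology_compatible lcE)).
  exact: (seminorm_ball_open null_seminorms_seminorm null_seminorms_scale).
have : nbhs (0 : lcs mu) O.
  apply: open_nbhs_nbhs; split=> //; rewrite /O /= subr0.
  by rewrite (seminorm0 (null_seminorms_seminorm qz)) ltr01.
apply: filterS => chi; rewrite /O /= subr0 => chi1 n.
have := le_lt_trans (null_seminorm_ge chi n z0) chi1.
rewrite /z (linear_formZ (dual_linear chi)) modulusM modulus_emb gtr0_norm //.
by rewrite mulrC ltr_pdivrMr // mul1r.
Qed.

(** * Precompact sets are limited *)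

Lemma totally_bounded_limited (p : \bar R) (mu : lc_topology (dual E)) (B : set (lcs mu)) :
  (1 <= p)%E -> locally_complete E -> is_mackey mu -> B !=set0 ->
  totally_bounded B -> p_oo_limited p B.
Proof.
move=> p1 lcE mum B0 tbB; split=> // chi chip.
have /choice[x chix] : forall n, exists x, forall psi : dual E, chi n psi = psi x.
  move=> n; apply: (mum.1 (chi n)).1; split.
    exact: dual_linear.
  exact: dual_continuous.
have x0 : weakly_null x.
  apply/weakly_nullP => psi e e0.
  by have := lp_null p1 (chip psi) e0; apply: filterS => n; rewrite chix.
have small e : 0 < e -> \forall n \near \oo, forall b, B b -> modulus (chi n b) < e.
  move=> e0; have e2 : 0 < e / 2 by rewrite divr_gt0.
  have [S /finite_seqP[s ->] BS] := tbB _ (mackey_null_neighborhood lcE mum x0 e2).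
  have : \forall n \near \oo, forall b, b \in s -> modulus ((b : dual E) (x n)) < e / 2.
    by apply: near_forall_seq => b _; exact: ((weakly_nullP x).1 x0 b _ e2).
  apply: filterS => n sn b /BS[c /= cs [u un <-]].
  rewrite (linear_formD (dual_linear (chi n))) !chix.
  apply: le_lt_trans (modulusD _ _) _.
  by rewrite [e]splitr ltrD // ?sn ?un.
have sup0 n : (0 <= ereal_sup [set (modulus (chi n b))%:E | b in B])%E.
  have [b Bb] := B0; apply: (@le_trans _ _ (modulus (chi n b))%:E).
    by rewrite lee_fin modulus_ge0.
  by apply: (@ereal_sup_ubound R); exists b.
have sup_le e : 0 < e -> \forall n \near \oo,
    (ereal_sup [set (modulus (chi n b))%:E | b in B] <= e%:E)%E.
  move=> /small; apply: filterS => n Bn; apply: ub_ereal_sup => _ [b Bb <-].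
  by rewrite lee_fin ltW // Bn.
apply/fine_cvgP; split.
  have := sup_le 1 ltr01; apply: filterS => n n1.
  by rewrite ge0_fin_numE // (le_lt_trans n1) // ltry.
apply/cvgrPdist_le => e e0; have := sup_le e e0; apply: filterS => n ne /=.
rewrite sub0r normrN ger0_norm ?fine_ge0 //.
rewrite -lee_fin fineK //.
by rewrite ge0_fin_numE // (le_lt_trans ne) // ltry.
Qed.

End NullSequenceTopology.

Theorem theorem3p16 (R : realType) (F : scalar_kind) (p : \bar R)
    (E : tvsType (scalars R F)) (mu : lc_topology (dual E)) :
  (1 <= p)%E ->
  hausdorff_space E ->
  weakly_p_angelic p E ->
  locally_complete E ->
  is_mackey mu ->
  forall B : set (lcs mu), B !=set0 -> tvs_bounded B ->
    (totally_bounded B <-> p_oo_limited p B).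
Proof.
move=> p1 _ [angelic _] lcE mum B B0 bB; split.
  exact: (totally_bounded_limited p1 lcE mum B0).
apply: (limited_totally_bounded mum.1) => // A; exact: (angelic A).2.
Qed.
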